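(* Let $k\in 2\mathbb{Z}$, let $f\in M_k$ be a modular form of weight $k$ for $SL_2(\mathbb{Z})$, let $l\in 2\mathbb{N}$ with $l\ge 4$, and let $m,N\in\mathbb{N}_0$. If $f$ is not a cusp form, assume in addition that $l\ge k+2$. Set $$\phi(\tau)=q^N\sum_{r=0}^m(-1)^r\binom{k+m-1}{m-r}\binom{l+m-1}{r}N^{m-r}D^rf(\tau).$$ Then $$[f,P_{l,N}]_m=\mathbb{P}_{k+l+2m}(\phi).$$
   Context: Let $\mathbb{H}$ be the upper half-plane, $\tau\in\mathbb{H}$, $q=e^{2\pi i\tau}$, and $D=\frac{1}{2\pi i}\frac{d}{d\tau}=q\frac{d}{dq}$. Let $\Gamma=SL_2(\mathbb{Z})$ and let $\Gamma_\infty\le\Gamma$ be the subgroup generated by $\pm\begin{pmatrix}1&1\\0&1\end{pmatrix}$. $M_k$ is the space of holomorphic modular forms of weight $k$ for $\Gamma$ (holomorphic on $\mathbb{H}$, weight-$k$ invariant, Fourier expansion $\sum_{n\ge0}a_nq^n$); a cusp form is a modular form with $a_0=0$. For $M=\begin{pmatrix}a&b\\c&d\end{pmatrix}\in\Gamma$ the weight $k$ slash operator is $(\phi|_kM)(\tau)=(c\tau+d)^{-k}\phi\left(\frac{a\tau+b}{c\tau+d}\right)$. Poincaré series: for even $k\ge4$ and a $q$-series $\phi(\tau)=\sum_{n=0}^\infty a_nq^n$ on $\mathbb{H}$ whose coefficients grow slowly enough, $$\mathbb{P}_k(\phi;\tau)=\sum_{M\in\Gamma_\infty\backslash\Gamma}(\phi|_kM)(\tau)=\frac12\sum_{c,d}\sum_{n=0}^\infty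 a_n(c\tau+d)^{-k}e^{2\pi i n\frac{a\tau+b}{c\tau+d}},$$ where $(c,d)$ runs over all pairs of coprime integers and $a,b$ are chosen with $ad-bc=1$; the sum over cosets converges absolutely and uniformly on compact subsets. Write $P_{k,N}=\mathbb{P}_k(q^N)$ for $N\in\mathbb{N}_0$; in particular $P_{k,0}=E_k=\mathbb{P}_k(1)$ is the normalized Eisenstein series. Rankin-Cohen brackets: for $f\in M_k$, $g\in M_l$, $n\in\mathbb{N}_0$, $$[f,g]_n=\sum_{j=0}^n(-1)^j\binom{k+n-1}{n-j}\binom{l+n-1}{j}D^jf\,D^{n-j}g .$$ Conventions: $\binom{x}{j}=x(x-1)\cdots(x-j+1)/j!$ and $0^0=1$. *)

(* Defs.v *)
(* MathComp world.  The complex numbers are R[i] for R : realType; functions on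
   the upper half-plane are total functions R[i] -> R[i], of which only the
   values on the upper half-plane matter. *)
From mathcomp Require Import all_boot all_order all_algebra generic_quotient.
From mathcomp Require Import all_classical all_reals all_analysis.
From mathcomp.real_closed Require Import complex.
From mathcomp.analysis.showcase Require summability.
Import Order.TTheory GRing.Theory Num.Theory.
Import numFieldNormedType.Exports.

Set Implicit Arguments.
Unset Strict Implicit.
Unset Printing Implicit Defensive.

Local Open Scope classical_set_scope.
Local Open Scope ring_scope.

Definition SL2Z := {M : 'M[int]_2 | \det M == 1}.

Definition Tmx : 'M[int]_2 :=
  \matrix_(i < 2, j < 2) (if (i <= j)%N then 1 else 0).

Inductive Gamma_infty : 'M[int]_2 -> Prop :=
| Gamma_infty1 : Gamma_infty 1
| Gamma_inftyT : Gamma_infty Tmx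
| Gamma_inftyNT : Gamma_infty (- Tmx)
| Gamma_inftyM g h : Gamma_infty g -> Gamma_infty h -> Gamma_infty (g * h)
| Gamma_inftyV g : Gamma_infty g -> Gamma_infty g^-1.

Definition same_coset (M M' : SL2Z) : bool :=
  `[< exists2 g, Gamma_infty g & val M = g * val M' >].

Lemma same_coset_refl : reflexive same_coset.
Proof.
by move=> M; apply/asboolP; exists 1; [exact: Gamma_infty1|rewrite mul1r].
Qed.

Lemma same_coset_sym : symmetric same_coset.
Proof.
suff H M M' : same_coset M M' -> same_coset M' M.
  by move=> M M'; apply/idP/idP; exact: H.
move=> /asboolP[g Gg MgM']; apply/asboolP; exists g^-1.
  exact: Gamma_inftyV.
rewrite MgM' mulKr // unitmxE.
have := valP M; rewrite MgM' -[_ * _]/(g *m val M') det_mulmx (eqP (valP M')).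
by rewrite mulr1 => /eqP->; rewrite unitr1.
Qed.

Lemma same_coset_trans : transitive same_coset.
Proof.
move=> M2 M1 M3 /asboolP[g Gg e1] /asboolP[h Gh e2]; apply/asboolP.
by exists (g * h); [exact: Gamma_inftyM|rewrite e1 e2 mulrA].
Qed.

Canonical same_coset_equiv :=
  EquivRel same_coset same_coset_refl same_coset_sym same_coset_trans.

(* The set of right cosets Gamma_infty \ SL2(Z). *)
Definition cosets := {eq_quot same_coset}%qT.

Section ModularForms.
Variable R : realType.
Local Notation C := (R[i]).

Definition upper_half_plane : set C := [set tau | 0 < complex.Im tau].

Definition cexp (z : C) : C :=
  (expR (complex.Re z))%:C%C * (cos (complex.Im z) +i* sin (complex.Im z))%C.

Definition two_pi_i : C := (0 +i* (2 * pi))%C.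

Definition q (tau : C) : C := cexp (two_pi_i * tau).

(* Complex differentiability and derivative: R[i]^o is R[i] as a normed space
   over R[i], so the limits below are taken along complex increments. *)
Definition holomorphic_at (f : C -> C) (tau : C) : Prop :=
  derivable (f : C^o -> C^o) tau 1.

Definition D (f : C -> C) : C -> C :=
  fun tau => two_pi_i^-1 * derive1 (f : C -> C^o) tau.

Definition slash (k : int) (phi : C -> C) (M : 'M[int]_2) : C -> C :=
  fun tau =>
    let a : C := (M 0 0)%:~R in let b : C := (M 0 1)%:~R in
    let c : C := (M 1 0)%:~R in let d : C := (M 1 1)%:~R in
    (c * tau + d) ^ (- k) * phi ((a * tau + b) / (c * tau + d)).

Definition fourier_expansion (a : nat -> C) (f : C -> C) : Prop :=
  forall tau, upper_half_plane tau ->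
    series (fun n => a n * q tau ^+ n : C^o) @ \oo --> (f tau : C^o).

Definition modular_form (k : int) (f : C -> C) : Prop :=
  [/\ forall tau, upper_half_plane tau -> holomorphic_at f tau,
      forall (M : SL2Z) tau, upper_half_plane tau ->
        slash k f (val M) tau = f tau
    & exists a, fourier_expansion a f].

Definition cusp_form (k : int) (f : C -> C) : Prop :=
  modular_form k f /\ exists2 a, fourier_expansion a f & a 0%N = 0.

(* x (x - 1) ... (x - j + 1) / j! *)
Definition gbinomial (x : int) (j : nat) : C :=
  (\prod_(i < j) (x%:~R - i%:R)) / (j`!)%:R.

Definition rankin_cohen (k l : int) (n : nat) (f g : C -> C) : C -> C :=
  fun tau => \sum_(j < n.+1)
    (-1) ^+ j * gbinomial (k + n%:Z - 1) (n - j) * gbinomial (l + n%:Z - 1) j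
    * iter j D f tau * iter (n - j) D g tau.

(* repr picks a representative of a coset; the choice is irrelevant when k is
   even and phi is 1-periodic, in particular when phi is a q-series. *)
Definition poincare_term (k : int) (phi : C -> C) (tau : C) (x : cosets) : C :=
  slash k phi (val (repr x)) tau.

(* Unordered sum, i.e. the limit along the net of finite sets of cosets. *)
Definition poincare (k : int) (phi : C -> C) : C -> C :=
  fun tau => summability.sum (poincare_term k phi tau : cosets -> C^o).

Definition poincare_abs_cvg (k : int) (phi : C -> C) (tau : C) : Prop :=
  summable [set: cosets]
    (fun x => (complex.Re `|poincare_term k phi tau x|)%:E).

Definition poincareN (k : int) (N : nat) : C -> C :=
  poincare k (fun tau => q tau ^+ N).

End ModularForms.

(* Main.v *)
Require Import Defs.
From mathcomp Require Import all_boot all_order all_algebra generic_quotient.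
From mathcomp Require Import all_classical all_reals all_analysis.
From mathcomp.real_closed Require Import complex.
From mathcomp.analysis.showcase Require summability.
From mathcomp Require Import finmap.
From mathcomp Require Import ring lra zify.
Import Order.TTheory GRing.Theory Num.Theory.
Import numFieldNormedType.Exports.
Import Normc.

Set Implicit Arguments.
Unset Strict Implicit.
Unset Printing Implicit Defensive.

Local Open Scope classical_set_scope.
Local Open Scope ring_scope.

(** Write P for the Poincare series of q^N in weight l, that is, the sum of
    q^N|_l M over the cosets of M. Brackets commute with the slash action,
    [f|_k M, g|_l M]_m = [f, g]_m |_(k+l+2m) M, and f|_k M = f. Taking the
    bracket of f with P term by term therefore yields the sum over the cosets of
    [f, q^N]_m |_(k+l+2m) M, and [f, q^N]_m is phi because D^i q^N = N^i q^N.
    At a fixed point tau this sum is a combination, with coefficients depending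
    only on the derivatives of f at tau, of the series of the derivatives of
    q^N|_l M of order at most m, so its absolute convergence is that of these
    series. Two facts remain: the commutation and the termwise differentiation.

    Commutation ([rc_slash_chain]). With w = c / (2 pi i (c tau + d)), the
    derivative D^n (f|_s M) is a polynomial in -w whose coefficients are multiples
    of the (D^j f)|_(s+2j) M ([D_chain_slash]). Differentiating this polynomial
    with respect to its variable lowers n by one, and the binomial coefficients of
    the bracket are such that the derivative of the whole bracket telescopes to 0
    ([rc_quasi_poly]). Hence only the constant terms survive, and they form the
    bracket of f and g slashed in weight k+l+2m.

    Termwise differentiation ([D_chain_sum]). If each derivative of a family of
    functions is dominated, locally uniformly, by a summable family of constants,
    then the mean value inequality bounds the first-order Taylor remainders by
    summable multiples of |h|^2, and the sum of the family can be differentiated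
    termwise at every order. For the cosets the dominating family is a multiple of
    (|c| + |d|)^-4, summable as l >= 4 ([locally_dominated_slash_qpow]). The same
    lemma applied to the Fourier expansion of f provides the derivatives of f of
    all orders ([fourier_chain]). *)

(** * Derivatives by estimates *)

Section Derive1.
Variable K : numFieldType.
Implicit Types (f : K^o -> K^o) (a v : K^o).

(** The form with a remainder bounded by a small multiple of [`|h|] is the one in
    which remainders can be added up, composed and summed over a family. *)
Lemma is_derive1P f a v :
  is_derive a 1 f v <->
  forall e : K, 0 < e -> exists2 d : K, 0 < d &
    forall h, `|h| < d -> `|f (a + h) - f a - h * v| <= e * `|h|.
Proof.
have eqv h : h != 0 ->
    `|f (a + h) - f a - h * v| =
      `|v - h^-1 * (f (h *: (1:K^o) + a) - f a)| * `|h|.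
  move=> h0; rewrite -normrM mulrBl [_ * _ * h]mulrAC mulVf// mul1r distrC.
  by rewrite [h *: _]mulr1 [a + h]addrC [v * h]mulrC.
split=> [[df dv] e e0|H].
  have /cvgrPdist_le /(_ e e0) :
      (fun h => h^-1 *: (f (h *: (1:K^o) + a) - f a)) @ 0^' --> v.
    by rewrite -dv; exact: df.
  rewrite /dnbhs/= near_withinE => /nbhs_ballP[d /= d0 D].
  exists d => // h hd; have [->|h0] := eqVneq h 0.
    by rewrite normr0 addr0 mul0r subrr subr0 normr0 mulr0.
  rewrite eqv// ler_pM2r ?normr_gt0//; apply: D => //.
  by rewrite -ball_normE /ball_ /= sub0r normrN.
have cv : (fun h => h^-1 *: (f (h *: (1:K^o) + a) - f a)) @ 0^' --> v.
  apply/cvgrPdist_le => e e0; have [d d0 D] := H e e0.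
  rewrite /dnbhs/= near_withinE; apply/nbhs_ballP; exists d => // h /=.
  rewrite -ball_normE /ball_ /= sub0r normrN => hd h0.
  by have := D h hd; rewrite eqv// ler_pM2r// normr_gt0.
split; first by apply/cvg_ex; exists v.
exact/(cvg_lim (@norm_hausdorff _ _)).
Qed.

End Derive1.

Section Modulus.
Variable R : realType.
Local Notation C := (R[i]).
Implicit Types z w : C.

Lemma normcE z : `|z| = (normc z)%:C%C. Proof. by []. Qed.

Lemma normc_ge0 z : 0 <= normc z.
Proof. by rewrite -lecR -normcE normr_ge0. Qed.

Lemma normc_gt0 z : z != 0 -> 0 < normc z.
Proof. by move=> z0; rewrite -ltcR -normcE normr_gt0. Qed.

Lemma normcX z n : normc (z ^+ n) = normc z ^+ n.
Proof. by apply: complexI; rewrite -normcE normrX normcE rmorphXn. Qed.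

Lemma normcXz z (n : int) : normc (z ^ n) = normc z ^ n.
Proof.
by case: n => n; rewrite ?NegzE -?exprnN -?exprnP ?normcV normcX.
Qed.

Lemma normc_real (x : R) : normc x%:C%C = `|x|.
Proof. by rewrite /normc/= expr0n addr0 sqrtr_sqr. Qed.

Lemma normc_nat n : normc (n%:R : C) = n%:R.
Proof.
by apply: complexI; rewrite -normcE ger0_norm ?ler0n// rmorph_nat.
Qed.

Lemma normc_sum (I : Type) (r : seq I) (F : I -> C) :
  normc (\sum_(i <- r) F i) <= \sum_(i <- r) normc (F i).
Proof.
elim/big_rec2: _ => [|i y x _ h]; first by rewrite normc0.
by apply: le_trans (le_normcD _ _) _; rewrite lerD2l.
Qed.

Lemma ler_normc_Re z : `|complex.Re z| <= normc z.
Proof. by rewrite -lecR -normcE normc_ge_Re. Qed.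

Lemma ler_normc_Im z : `|complex.Im z| <= normc z.
Proof.
case: z => x y /=; rewrite -[leLHS]sqrtr_sqr ler_wsqrtr// lerDr.
exact: sqr_ge0.
Qed.

Lemma normc_le_ReIm z : normc z <= `|complex.Re z| + `|complex.Im z|.
Proof.
case: z => x y /=; rewrite -[leRHS]ger0_norm ?addr_ge0// -sqrtr_sqr.
rewrite ler_wsqrtr// sqrrD !real_normK ?num_real// -addrA addrCA lerDr.
by rewrite mulrn_wge0 ?mulr_ge0.
Qed.

(** Moduli are taken in [R], where the order is total, rather than in [R[i]]. *)
Lemma is_derive_normcP (f : C -> C) z w :
  is_derive (z : C^o) 1 (f : C^o -> C^o) w <->
  forall e : R, 0 < e -> exists2 d : R, 0 < d & forall h : C, normc h < d ->
    normc (f (z + h) - f z - h * w) <= e * normc h.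
Proof.
split=> [/is_derive1P H e e0|H].
  have [|d d0 D] := H e%:C%C; first by rewrite ltcR.
  have dE : d = (complex.Re d)%:C%C by rewrite RRe_real// gtr0_real.
  exists (complex.Re d) => [|h hd]; first by rewrite -ltcR -dE.
  by rewrite -lecR rmorphM/=; apply: D; rewrite dE normcE ltcR.
apply/is_derive1P => e e0.
have eE : e = (complex.Re e)%:C%C by rewrite RRe_real// gtr0_real.
have [|d d0 D] := H (complex.Re e); first by rewrite -ltcR -eE.
exists d%:C%C => [|h]; first by rewrite ltcR.
by rewrite normcE ltcR => /D; rewrite [in e * _]eE -rmorphM -lecR.
Qed.

(** A quadratic bound on the remainder survives an infinite summation, whereas a
    mere o(h) does not; sums are differentiated through this criterion. *)
Lemma is_derive_quadratic (f : C -> C) z w (d B : R) : 0 < d ->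
  (forall h : C, normc h < d ->
     normc (f (z + h) - f z - h * w) <= B * normc h ^+ 2) ->
  is_derive (z : C^o) 1 (f : C^o -> C^o) w.
Proof.
move=> d0 H; apply/is_derive_normcP => e e0.
have B1 : 0 < `|B| + 1 by rewrite ltr_wpDl.
exists (Num.min d (e / (`|B| + 1))) => [|h].
  by rewrite lt_min d0 divr_gt0.
rewrite lt_min => /andP[/H/le_trans hd he]; apply: hd.
rewrite expr2 mulrA ler_wpM2r ?normc_ge0//.
apply: (@le_trans _ _ ((`|B| + 1) * normc h)).
  by rewrite ler_wpM2r ?normc_ge0// (le_trans (ler_norm _))// lerDl.
by rewrite mulrC -ler_pdivlMr// ltW.
Qed.

(** This is the reduction of the complex mean value inequality to the real one. *)
Lemma is_derive_Re_line (f : C -> C) z w v (t : R) :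
  is_derive (z + t%:C%C * w : C^o) 1 (f : C^o -> C^o) v ->
  is_derive (t : R^o) 1
    (fun s : R^o => complex.Re (f (z + (s%:C%C * w))) : R^o)
    (complex.Re (w * v)).
Proof.
move/is_derive_normcP => H; apply/is_derive1P => e e0.
have W0 : 0 < normc w + 1 by rewrite ltr_wpDl// normc_ge0.
have [|d d0 D] := H (e / (normc w + 1)); first by rewrite divr_gt0.
exists (d / (normc w + 1)) => [|h hd]; first by rewrite divr_gt0.
have hw : normc (h%:C%C * w) <= `|h| * (normc w + 1).
  by rewrite normcM normc_real ler_wpM2l// lerDl.
have /D : normc (h%:C%C * w) < d.
  by apply: le_lt_trans hw _; rewrite -ltr_pdivlMr.
have -> : z + t%:C%C * w + h%:C%C * w = z + (t + h)%:C%C * w.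
  by rewrite rmorphD /= mulrDl addrA.
move=> {}D; apply: le_trans (le_trans D _).
  apply: le_trans (ler_normc_Re _).
  set X := f _; set Y := f _.
  case: (X) (Y) (w) (v) => [x1 x2] [y1 y2] [w1 w2] [v1 v2] /=.
  by rewrite le_eqVlt; apply/orP; left; apply/eqP; congr (`| _ |); ring.
rewrite mulrAC ler_pdivrMr// -mulrA; apply: ler_wpM2l => //; exact: ltW.
Qed.

Lemma Re_mean_value (f f' : C -> C) z h (B : R) :
  (forall k, normc k <= normc h ->
     is_derive (z + k : C^o) 1 (f : C^o -> C^o) (f' (z + k))) ->
  (forall k, normc k <= normc h -> normc (f' (z + k)) <= B) ->
  complex.Re (f (z + h) - f z) <= B * normc h.
Proof.
move=> df bf.
have hs (s : R) : s \in `[0, 1] -> normc (s%:C%C * h) <= normc h.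
  rewrite in_itv /= => /andP[s0 s1]; rewrite normcM normc_real ger0_norm//.
  by rewrite ler_piMl ?normc_ge0.
pose g (s : R) : R := complex.Re (f (z + s%:C%C * h)).
have dg (s : R) : s \in `[0, 1] ->
    is_derive (s : R^o) 1 (g : R^o -> R^o)
      (complex.Re (h * f' (z + s%:C%C * h))).
  by move=> /hs s01; apply: is_derive_Re_line; exact: df.
have cg : {within `[0, 1], continuous (g : R^o -> R^o)}.
  by apply: derivable_within_continuous => s /dg[].
have dg' (s : R) : s \in `]0, 1[ -> is_derive (s : R^o) 1 (g : R^o -> R^o)
      (complex.Re (h * f' (z + s%:C%C * h))).
  by move=> s01; apply: dg; apply: subset_itv_oo_cc.
have [s s01 E] := MVT_segment ler01 dg' cg.
have -> : complex.Re (f (z + h) - f z) = g 1 - g 0.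
  by rewrite /g !(rmorph0, rmorph1) mul0r mul1r addr0; case: (f _) (f _) => [? ?] [].
rewrite E subr0 mulr1 (le_trans (ler_norm _))// (le_trans (ler_normc_Re _))//.
rewrite normcM mulrC ler_wpM2r ?normc_ge0//.
exact/bf/hs.
Qed.

(** The bound on real parts is applied to f, -f, i f and -i f; the constant 4 is
    not sharp. *)
Lemma mean_value_bound (f f' : C -> C) z h (B : R) :
  (forall k, normc k <= normc h ->
     is_derive (z + k : C^o) 1 (f : C^o -> C^o) (f' (z + k))) ->
  (forall k, normc k <= normc h -> normc (f' (z + k)) <= B) ->
  normc (f (z + h) - f z) <= 4 * B * normc h.
Proof.
move=> df bf.
have rot (c : C) : normc c = 1 ->
    complex.Re (c * (f (z + h) - f z)) <= B * normc h.
  move=> c1; rewrite mulrBr.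
  apply: (@Re_mean_value (fun w => c * f w) (fun w => c * f' w) z).
    by move=> k kd; have := df k kd => ?; exact: is_deriveZ.
  by move=> k kd; rewrite normcM c1 mul1r; exact: bf.
set D := f _ - f z in rot *.
have n1 : normc (1 : C) = 1 by exact: normc1.
have ni : normc ('i%C : C) = 1 by rewrite /normc/= expr0n expr1n add0r sqrtr1.
have := rot 1 n1; have := rot (-1) _; rewrite normcN n1 => /(_ erefl).
have := rot 'i%C ni; have := rot (- 'i%C) _; rewrite normcN ni => /(_ erefl).
have := normc_le_ReIm D.
case: (D) => x y /=.
rewrite !(mul0r, mul1r, mulN1r, oppr0, add0r, addr0, subr0, sub0r, opprK).
move=> H1 H2 H3 H4 H5; apply: le_trans H1 _.
by case: (ger0P x) => _; case: (ger0P y) => _; lra.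
Qed.

(** The mean value inequality is applied first to f' and then to
    w |-> f w - f' z * w, whose derivative f' w - f' z is small. *)
Lemma taylor1_bound (f f' f'' : C -> C) z h (B : R) :
  (forall k, normc k <= normc h ->
     is_derive (z + k : C^o) 1 (f : C^o -> C^o) (f' (z + k))) ->
  (forall k, normc k <= normc h ->
     is_derive (z + k : C^o) 1 (f' : C^o -> C^o) (f'' (z + k))) ->
  (forall k, normc k <= normc h -> normc (f'' (z + k)) <= B) ->
  normc (f (z + h) - f z - h * f' z) <= 16 * B * normc h ^+ 2.
Proof.
move=> df df' bf.
have B0 : 0 <= B.
  by apply: le_trans (normc_ge0 _) (bf 0 _); rewrite normc0 normc_ge0.
have := @mean_value_bound (fun w => f w - f' z * w) (fun w => f' w - f' z)
   z h (4 * B * normc h).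
have -> : f (z + h) - f' z * (z + h) - (f z - f' z * z)
   = f (z + h) - f z - h * f' z by ring.
have -> : 4 * (4 * B * normc h) * normc h = 16 * B * normc h ^+ 2 by ring.
apply=> k kh.
  have ? := df k kh; apply: is_deriveB.
  by rewrite -[in X in is_derive _ _ _ X](mulr1 (f' z)); exact: is_deriveZ.
apply: le_trans (_ : 4 * B * normc k <= _); last by rewrite ler_wpM2l ?mulr_ge0.
apply: mean_value_bound => j jk; first by apply: df'; exact: le_trans kh.
by apply: bf; exact: le_trans kh.
Qed.
End Modulus.

(** * Derivatives of powers, compositions and the exponential *)

Section Chain.
Variable K : numFieldType.

Lemma is_derive_exprn (g : K^o -> K^o) (a dg : K^o) (n : nat) :
  is_derive a 1 g dg ->
  is_derive a 1 (fun z => g z ^+ n : K^o) (n%:R * g a ^+ n.-1 * dg).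
Proof.
move=> Dg; rewrite (_ : (fun _ => _) = g ^+ n); last by rewrite exprfctE.
exact: is_deriveX.
Qed.

Lemma is_derive_inv (g : K^o -> K^o) (a dg : K^o) : g a != 0 ->
  is_derive a 1 g dg ->
  is_derive a 1 (fun z => (g z)^-1 : K^o) (- (dg / g a ^+ 2)).
Proof.
move=> ga0 [Dg1 Dg2]; split; first exact: derivableV.
by rewrite deriveV// Dg2 [LHS]mulNr mulrC.
Qed.

Lemma is_derive_exprz (g : K^o -> K^o) (a dg : K^o) (n : int) : g a != 0 ->
  is_derive a 1 g dg ->
  is_derive a 1 (fun z => g z ^ n : K^o) (n%:~R * g a ^ (n - 1) * dg).
Proof.
move=> ga0 Dg.
have DX m := is_derive_exprn m Dg.
case: n => n.
  have := DX n; case: n => [|n]; first by rewrite !mul0r.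
  by rewrite (_ : n.+1%:Z - 1 = n)//; lia.
have gn0 : g a ^+ n.+1 != 0 by rewrite expf_neq0.
have := @is_derive_inv (fun z => g z ^+ n.+1) a _ gn0 (DX n.+1).
congr (is_derive _ _ _ _).
rewrite NegzE -opprD -PoszD addn1 -exprnN mulrNz -pmulrn.
have yn0 : g a ^+ n != 0 by rewrite expf_neq0.
rewrite !exprS /= in gn0 *.
by move: (_ ^+ n) yn0 => y y0; field; rewrite y0.
Qed.
End Chain.

Section CExp.
Variable R : realType.
Local Notation C := (R[i]).
Implicit Types z w : C.

Lemma is_derive_comp (f g : C -> C) z w v :
  is_derive (z : C^o) 1 (g : C^o -> C^o) w ->
  is_derive (g z : C^o) 1 (f : C^o -> C^o) v ->
  is_derive (z : C^o) 1 (f \o g : C^o -> C^o) (v * w).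
Proof.
move=> /is_derive_normcP Dg /is_derive_normcP Df; apply/is_derive_normcP.
move=> e e0.
have W0 : 0 < normc w + 1 by rewrite ltr_wpDl// normc_ge0.
have V0 : 0 < normc v + 1 by rewrite ltr_wpDl// normc_ge0.
have [|d1 d10 D1] := Df (e / 2 / (normc w + 1)); first by rewrite !divr_gt0.
have [|d2 d20 D2] := Dg (Num.min 1 (e / 2 / (normc v + 1))).
  by rewrite lt_min ltr01 !divr_gt0.
exists (Num.min d2 (d1 / (normc w + 1))) => [|h].
  by rewrite lt_min d20 divr_gt0.
rewrite lt_min => /andP[/D2 + hd].
set k := g (z + h) - g z => hk.
have k1 : normc k <= (normc w + 1) * normc h.
  rewrite -(subrK (h * w) k) (le_trans (le_normcD _ _))// normcM.
  rewrite [in leRHS]mulrDl addrC [normc h * _]mulrC lerD2l (le_trans hk)//.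
  by rewrite ler_wpM2r ?normc_ge0// ge_min lexx.
have /D1 : normc k < d1.
  by apply: le_lt_trans k1 _; rewrite mulrC -ltr_pdivlMr.
rewrite [g z + k]addrC subrK => fk /=.
rewrite (_ : _ - _ - _ = (f (g (z + h)) - f (g z) - k * v) + (k - h * w) * v);
  last by rewrite /=; ring.
apply: le_trans (le_normcD _ _) _.
rewrite (_ : e * _ = e / 2 * normc h + e / 2 * normc h); last by field.
apply: lerD.
  apply: le_trans fk _.
  apply: le_trans (_ : e / 2 / (normc w + 1) * ((normc w + 1) * normc h) <= _).
    by rewrite ler_wpM2l// ltW// !divr_gt0.
  by rewrite mulrA divfK ?gt_eqF.
rewrite normcM.
apply: le_trans (_ : e / 2 / (normc v + 1) * normc h * (normc v + 1) <= _).
  apply: ler_pM; rewrite ?normc_ge0//; last by rewrite lerDl.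
  by apply: le_trans hk _; rewrite ler_wpM2r ?normc_ge0// ge_min lexx orbT.
by rewrite mulrAC divfK ?gt_eqF// mulrAC.
Qed.

Lemma cexpD z w : cexp (z + w) = cexp z * cexp w.
Proof.
case: z w => [a b] [c d]; rewrite /cexp/= expRD cosD sinD.
by apply/eqP; rewrite eq_complex/=; apply/andP; split; apply/eqP; ring.
Qed.

Lemma normc_cexp z : normc (cexp z) = expR (complex.Re z).
Proof.
rewrite /cexp normcM normc_real ger0_norm ?expR_ge0//.
by rewrite /normc/= cos2Dsin2 sqrtr1 mulr1.
Qed.

(** The functional equation leaves the point 0. There, with h = x + i y, the real
    part of e^h - 1 - h is (e^x - 1 - x) cos y + (1 + x) (cos y - 1) and its
    imaginary part (e^x - 1 - x) sin y + (1 + x) (sin y - y) + x y, so that the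
    derivatives of the real functions at 0 suffice. *)
Lemma is_derive_cexp z : is_derive (z : C^o) 1 (@cexp R : C^o -> C^o) (cexp z).
Proof.
suff H : forall e : R, 0 < e -> exists2 d : R, 0 < d & forall h : C,
    normc h < d -> normc (cexp h - 1 - h) <= e * normc h.
  apply/is_derive_normcP => e e0.
  have [|d d0 D] := H (e / normc (cexp z)).
    by rewrite divr_gt0// normc_cexp expR_gt0.
  exists d => // h /D hd.
  rewrite cexpD (_ : _ - _ - _ = cexp z * (cexp h - 1 - h)); last by ring.
  rewrite normcM mulrC -ler_pdivlMr ?normc_cexp ?expR_gt0//.
  by rewrite mulrAC -normc_cexp.
move=> e e0.
(* The error terms below add up to at most 7 (e / 8) |h|. *)
have e9 : 0 < e / 8 by rewrite divr_gt0.
have /is_derive1P /(_ _ e9)[d1 d10 D1] := is_derive_expR (0 : R).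
have /is_derive1P /(_ _ e9)[d2 d20 D2] := is_derive_cos (0 : R).
have /is_derive1P /(_ _ e9)[d3 d30 D3] := is_derive_sin (0 : R).
exists (Num.min (Num.min d1 d2) (Num.min d3 (Num.min 1 (e/8)))) => [|h].
  by rewrite !lt_min d10 d20 d30 ltr01 e9.
rewrite !lt_min => /andP[/andP[h1 h2] /andP[h3 /andP[h4 h5]]].
have hx := ler_normc_Re h; have hy := ler_normc_Im h.
have := D1 (complex.Re h) (le_lt_trans hx h1).
have := D2 (complex.Im h) (le_lt_trans hy h2).
have := D3 (complex.Im h) (le_lt_trans hy h3).
rewrite !(add0r, sin0, cos0, expR0, oppr0, mulr0, subr0, mulr1).
have n0 := normc_ge0 h; set n := normc h in hx hy h1 h2 h3 h4 h5 n0 *.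
set x := complex.Re h in hx *; set y := complex.Im h in hy *.
set A := expR x - 1 - x; set B := cos y - 1; set S := sin y - y.
move=> hS hB hA.
have x2 : `|1 + x| <= 2.
  rewrite (le_trans (ler_normD _ _))// normr1 -[2]/(1 + 1) lerD2l.
  by rewrite (le_trans hx)// ltW.
have e8 : 0 <= e / 8 by exact: ltW.
have An : `|A| <= e / 8 * n by rewrite (le_trans hA)// ler_wpM2l.
have Bn : `|B| <= e / 8 * n by rewrite (le_trans hB)// ler_wpM2l.
have Sn : `|S| <= e / 8 * n by rewrite (le_trans hS)// ler_wpM2l.
have xyn : `|x * y| <= e / 8 * n.
  by rewrite normrM ler_pM// (le_trans hx)// ltW.
have -> : cexp h - 1 - h =
    ((A * cos y + (1 + x) * B) +i* (A * sin y + (1 + x) * S + x * y))%C.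
  rewrite /A /B /S /x /y; case: (h) => a b /=.
  by apply/eqP; rewrite eq_complex/=; apply/andP; split; apply/eqP; ring.
apply: le_trans (normc_le_ReIm _) _ => /=.
have cs (u v : R) : `|v| <= 1 -> `|u * v| <= `|u|.
  by move=> v1; rewrite normrM ler_piMr.
have c1 : `|cos y| <= 1 by rewrite ler_norml cos_geN1 cos_le1.
have s1 : `|sin y| <= 1 by rewrite ler_norml sin_geN1 sin_le1.
have H1 : `|A * cos y + (1 + x) * B| <= e / 8 * n + 2 * (e / 8 * n).
  rewrite (le_trans (ler_normD _ _))// lerD//; first by rewrite (le_trans (cs A _ c1)).
  by rewrite normrM ler_pM.
have H2 : `|A * sin y + (1 + x) * S + x * y| <= e / 8 * n + 2 * (e / 8 * n) + e / 8 * n.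
  rewrite (le_trans (ler_normD _ _))// lerD//.
  rewrite (le_trans (ler_normD _ _))// lerD//; first by rewrite (le_trans (cs A _ s1)).
  by rewrite normrM ler_pM.
have en : 0 <= e * n by rewrite mulr_ge0// ltW.
by apply: le_trans (lerD H1 H2) _; lra.
Qed.

End CExp.

(** * Moebius transformations and the slash action *)

Section Mobius.
Variable R : realType.
Local Notation C := (R[i]).
Implicit Types (tau : C) (f g : C -> C) (M : 'M[int]_2).
Local Notation H := (@upper_half_plane R).
Local Notation tpi := (two_pi_i R).

Lemma two_pi_i_neq0 : tpi != 0.
Proof.
by rewrite eq_complex/= eqxx mulf_neq0//= ?pnatr_eq0// gt_eqF// pi_gt0.
Qed.

Lemma upper_half_plane_disc tau h : H tau -> normc h < complex.Im tau -> H (tau + h).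
Proof.
rewrite /upper_half_plane/= => t0 ht.
have := le_lt_trans (ler_normc_Im h) ht; rewrite ltr_norml => /andP[+ _].
by case: tau h t0 {ht} => [x y] [a b] /=; lra.
Qed.

Lemma is_derive_eq_upper f g tau v : H tau -> (forall z, H z -> f z = g z) ->
  is_derive (tau : C^o) 1 (g : C^o -> C^o) v ->
  is_derive (tau : C^o) 1 (f : C^o -> C^o) v.
Proof.
move=> t0 fg /is_derive_normcP Dg; apply/is_derive_normcP => e e0.
have [d d0 Dd] := Dg e e0; exists (Num.min d (complex.Im tau)) => [|h].
  by rewrite lt_min d0.
rewrite lt_min => /andP[hd ht]; rewrite !fg//; first exact: Dd.
exact: upper_half_plane_disc.
Qed.

(** Carrying all the iterated derivatives as one sequence records both that they
    exist and what they are. *)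
Definition D_chain (F : nat -> C -> C) : Prop := forall n tau, H tau ->
  is_derive (tau : C^o) 1 (F n : C^o -> C^o) (tpi * F n.+1 tau).

(** Only the values near tau enter, and the half-plane is open: f may be anything
    outside of it. *)
Lemma D_chain_iter f F : D_chain F -> (forall z, H z -> f z = F 0%N z) ->
  forall n tau, H tau -> iter n (@D R) f tau = F n tau.
Proof.
move=> cF fF; elim=> [|n IH] tau t0 /=; first exact: fF.
rewrite /D derive1E.
have [_ ->] := is_derive_eq_upper t0 IH (cF n tau t0).
by rewrite mulKf// two_pi_i_neq0.
Qed.

Lemma is_derive_q tau : is_derive (tau : C^o) 1 (@q R : C^o -> C^o) (tpi * q tau).
Proof.
have dl : is_derive (tau : C^o) 1 ((fun z => tpi * z) : C^o -> C^o) (tpi * 1).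
  by have ? := is_derive_id (tau : C^o) (1 : C^o); exact: is_deriveZ.
have := is_derive_comp dl (is_derive_cexp (tpi * tau)).
by rewrite mulr1 [cexp _ * _]mulrC.
Qed.

Lemma is_deriveMc f g tau v w :
  is_derive (tau : C^o) 1 (f : C^o -> C^o) v ->
  is_derive (tau : C^o) 1 (g : C^o -> C^o) w ->
  is_derive (tau : C^o) 1 ((fun z => f z * g z) : C^o -> C^o)
    (f tau * w + g tau * v).
Proof. exact: is_deriveM. Qed.

Lemma is_deriveZc f tau a v :
  is_derive (tau : C^o) 1 (f : C^o -> C^o) v ->
  is_derive (tau : C^o) 1 ((fun z => a * f z) : C^o -> C^o) (a * v).
Proof. by move=> ?; exact: is_deriveZ. Qed.

Lemma D_chain_qpow N : D_chain (fun n tau => N%:R ^+ n * q tau ^+ N).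
Proof.
move=> n tau _.
have := is_deriveZc (N%:R ^+ n) (is_derive_exprn N (is_derive_q tau)).
congr (is_derive _ _ _ _); rewrite exprSr.
case: N => [|N]; first by rewrite !(mulr0n, mul0r, mulr0).
by rewrite /= exprSr; ring.
Qed.

Definition den M tau : C := (M 1 0)%:~R * tau + (M 1 1)%:~R.
Definition mobius M tau : C := ((M 0 0)%:~R * tau + (M 0 1)%:~R) / den M tau.

Lemma slashE k f M tau : slash k f M tau = den M tau ^ (- k) * f (mobius M tau).
Proof. by []. Qed.

Lemma det2 M : \det M = 1 -> M 0 0 * M 1 1 - M 0 1 * M 1 0 = 1.
Proof.
rewrite (expand_det_row _ 0) !big_ord_recl big_ord0 /cofactor !det_mx11 !mxE /= => <-.
have -> : lift 0 0 = 1 :> 'I_2 by apply/val_inj.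
have -> : lift 1 0 = 0 :> 'I_2 by apply/val_inj.
by rewrite expr0 expr1; ring.
Qed.

Lemma intrC (n : int) : n%:~R = ((n%:~R : R)%:C)%C :> C.
Proof. by rewrite rmorph_int. Qed.

Lemma Im_den M tau : complex.Im (den M tau) = (M 1 0)%:~R * complex.Im tau.
Proof. by rewrite /den !intrC; case: tau => x y /=; ring. Qed.

Lemma Re_den M tau :
  complex.Re (den M tau) = (M 1 0)%:~R * complex.Re tau + (M 1 1)%:~R.
Proof. by rewrite /den !intrC; case: tau => x y /=; ring. Qed.

Lemma den_neq0 M tau : \det M = 1 -> H tau -> den M tau != 0.
Proof.
move=> /det2 dM t0; apply/eqP => d0.
have := Im_den M tau; rewrite d0 /= => /esym/eqP.
rewrite mulf_eq0 intr_eq0 => /orP[/eqP c0|]; last by rewrite gt_eqF.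
have := Re_den M tau; rewrite d0 c0 /= mul0r add0r => /esym/eqP.
rewrite intr_eq0 => /eqP d1; move: dM; rewrite c0 d1; lia.
Qed.

Lemma Im_mobius M tau : \det M = 1 -> H tau ->
  complex.Im (mobius M tau) = complex.Im tau / normc (den M tau) ^+ 2.
Proof.
move=> dM t0.
have dR : ((M 0 0)%:~R * (M 1 1)%:~R - (M 0 1)%:~R * (M 1 0)%:~R : R) = 1.
  by rewrite -!rmorphM -rmorphB/= (det2 dM).
have nE : normc (den M tau) ^+ 2 =
    complex.Re (den M tau) ^+ 2 + complex.Im (den M tau) ^+ 2.
  by case: (den M tau) => x y; rewrite /normc/= sqr_sqrtr// addr_ge0// sqr_ge0.
have n0 : normc (den M tau) ^+ 2 != 0.
  by rewrite expf_neq0// gt_eqF// normc_gt0// den_neq0.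
rewrite nE in n0 *; rewrite /mobius; move: n0 {nE}.
have := Im_den M tau; have := Re_den M tau.
case: (den M tau) => x y /= -> -> n0; rewrite !intrC.
move: dR n0; set a : R := (M 0 0)%:~R; set b : R := (M 0 1)%:~R.
set c : R := (M 1 0)%:~R; set d : R := (M 1 1)%:~R => dR n0.
case: tau t0 n0 => u v /= t0 n0.
rewrite [X in _ = X / _](_ : v = (a * d - b * c) * v); last by rewrite dR mul1r.
by field.
Qed.

Lemma upper_half_plane_mobius M tau : \det M = 1 -> H tau -> H (mobius M tau).
Proof.
move=> dM t0; rewrite /upper_half_plane/= Im_mobius// divr_gt0// exprn_gt0//.
by rewrite normc_gt0// den_neq0.
Qed.

Lemma is_derive_affine (a b : C) tau :
  is_derive (tau : C^o) 1 ((fun z => a * z + b) : C^o -> C^o) a.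
Proof.
have h := is_deriveZc a (is_derive_id (tau : C^o) (1 : C^o)).
have k := is_derive_cst (b : C^o) (tau : C^o) 1.
by have := is_deriveD h k; rewrite addr0 mulr1.
Qed.

Lemma is_derive_den M tau :
  is_derive (tau : C^o) 1 (den M : C^o -> C^o) (M 1 0)%:~R.
Proof. exact: is_derive_affine. Qed.

Lemma is_derive_mobius M tau : \det M = 1 -> H tau ->
  is_derive (tau : C^o) 1 (mobius M : C^o -> C^o) (den M tau ^- 2).
Proof.
move=> dM t0; have d0 := den_neq0 dM t0.
have h1 := is_derive_inv d0 (is_derive_den M tau).
have := is_deriveMc (is_derive_affine (M 0 0)%:~R (M 0 1)%:~R tau) h1.
congr (is_derive _ _ _ _).
have dC : ((M 0 0)%:~R * (M 1 1)%:~R - (M 0 1)%:~R * (M 1 0)%:~R : C) = 1.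
  by rewrite -!rmorphM -rmorphB/= (det2 dM).
rewrite -[X in _ = X](mul1r _) -[X in _ = X * _]dC; move: d0; rewrite /den => d0.
by field.
Qed.

(** The defect of D with respect to the slash action; D w = - w^2 by
    [is_derive_cocycle]. *)
Definition cocycle M tau : C := (M 1 0)%:~R / (tpi * den M tau).

Lemma is_derive_cocycle M tau : \det M = 1 -> H tau ->
  is_derive (tau : C^o) 1 (cocycle M : C^o -> C^o) (- (tpi * cocycle M tau ^+ 2)).
Proof.
move=> dM t0; have d0 := den_neq0 dM t0; have p0 := two_pi_i_neq0.
have h1 := is_derive_inv d0 (is_derive_den M tau).
have := is_deriveZc ((M 1 0)%:~R / tpi) h1.
rewrite (_ : (fun _ => _) = cocycle M); last first.
  by apply/funext => z; rewrite /cocycle invfM mulrA.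
congr (is_derive _ _ _ _).
rewrite /cocycle; by field; rewrite p0 d0.
Qed.

Lemma is_derive_slash (s : int) f f1 M tau : \det M = 1 -> H tau ->
  is_derive (mobius M tau : C^o) 1 (f : C^o -> C^o) (tpi * f1 (mobius M tau)) ->
  is_derive (tau : C^o) 1 (slash s f M : C^o -> C^o)
    (tpi * (slash (s + 2) f1 M tau
            - s%:~R * cocycle M tau * slash s f M tau)).
Proof.
move=> dM t0 df; have d0 := den_neq0 dM t0; have p0 := two_pi_i_neq0.
have h1 := is_derive_exprz (- s) d0 (is_derive_den M tau).
have h2 := is_derive_comp (is_derive_mobius dM t0) df.
have := is_deriveMc h1 h2.
congr (is_derive _ _ _ _).
have e1 (x : C) : x ^ (-1 : int) = x^-1 by rewrite exprN1.
have e2 (x : C) : x ^ (-2 : int) = (x ^+ 2)^-1 by [].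
rewrite !slashE /= /cocycle opprD !expfzDr// e1 e2.
move: (_ ^ (- s)) => X; rewrite rmorphN/=.
by field; rewrite p0 d0.
Qed.

End Mobius.

(** * Algebra of the Rankin-Cohen coefficients *)

Section Bracket.
Variable R : realType.
Local Notation C := (R[i]).
Implicit Types (s k l : int) (n j : nat) (x y : nat -> C).

Lemma gbinomialS s j :
  gbinomial R s j.+1 * j.+1%:R = gbinomial R s j * (s%:~R - j%:R).
Proof.
rewrite /gbinomial big_ord_recr/= factS natrM.
have f0 : (j`!)%:R != 0 :> C by rewrite pnatr_eq0 -lt0n fact_gt0.
have s0 : j.+1%:R != 0 :> C by rewrite pnatr_eq0.
by move: (j.+1%:R : C) s0 => u u0; field; rewrite u0 f0.
Qed.

(** These are the coefficients of the identity
    D^n (f|_s M) = sum_j quasi_coef s n j (-w)^(n-j) (D^j f)|_(s+2j) M,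
    where w is the cocycle of M. *)
Definition quasi_coef s n j : C :=
  'C(n, j)%:R * \prod_(i < n - j) (s%:~R + (j + i)%:R).

Lemma quasi_coef0 s n : quasi_coef s n.+1 0 = (s%:~R + n%:R) * quasi_coef s n 0.
Proof.
by rewrite /quasi_coef !bin0 !subn0 !mul1r big_ord_recr/= mulrC add0n.
Qed.

Lemma quasi_coef_diag s n : quasi_coef s n n = 1.
Proof. by rewrite /quasi_coef binn subnn big_ord0 mulr1. Qed.

Lemma quasi_coef_small s n j : (n < j)%N -> quasi_coef s n j = 0.
Proof. by move=> nj; rewrite /quasi_coef bin_small// mul0r. Qed.

(** The recursion that applying D once more to that identity imposes. *)
Lemma quasi_coefS s n j : (j <= n)%N ->
  quasi_coef s n.+1 j.+1 =
    (s%:~R + (n + j.+1)%:R) * quasi_coef s n j.+1 + quasi_coef s n j.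
Proof.
rewrite leq_eqVlt => /predU1P[->|jn].
  by rewrite !quasi_coef_diag quasi_coef_small// mulr0 add0r.
rewrite /quasi_coef subSS -(subnSK jn) big_ord_recr big_ord_recl/= addn0.
under [X in _ = _ + _ * (_ * X)]eq_bigr => i _ do rewrite /bump/= addnA addn1.
set p := \prod_(i < _) _.
rewrite addSnnS (subnSK jn) subnKC ?(ltnW jn)//.
have := mul_bin_left n j => /(congr1 (fun m => m%:R : C)).
rewrite !natrM natrB ?(ltnW jn)// => E.
rewrite binS !natrD.
move: ('C(n, j.+1)%:R : C) ('C(n, j)%:R : C) E => A B.
have -> : j.+1%:R = j%:R + 1 :> C by rewrite -addn1 natrD.
move=> E.
have F : (j%:R + 1) * A * p = (n%:R - j%:R) * B * p by rewrite E.
rewrite [LHS](_ : _ = (s%:~R + (n%:R + (j%:R + 1))) * (A * p)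
    + B * ((s%:~R + j%:R) * p) + ((n%:R - j%:R) * B * p - (j%:R + 1) * A * p));
  last by ring.
by rewrite F subrr addr0.
Qed.

Lemma quasi_coef_deriv s n j : (j <= n)%N ->
  quasi_coef s n.+1 j * (n.+1 - j)%:R = n.+1%:R * (s%:~R + n%:R) * quasi_coef s n j.
Proof.
move=> jn; rewrite /quasi_coef subSn// big_ord_recr/= subnKC//.
have := mul_bin_down n.+1 j => /(congr1 (fun m => m%:R : C)).
rewrite !natrM/= subSn// => E; rewrite mulrAC [_ * (_.+1)%:R]mulrC -E.
by ring.
Qed.

(** The right-hand side of the same identity with an indeterminate in place of -w
    and x j in place of (D^j f)|_(s+2j) M. *)
Definition quasi_poly s x n : {poly C} :=
  \sum_(j < n.+1) (quasi_coef s n j * x j) *: 'X^(n - j).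

Lemma horner0_quasi_poly s x n : (quasi_poly s x n).[0] = x n.
Proof.
rewrite /quasi_poly horner_sum big_ord_recr/= subnn hornerZ expr0 hornerC mulr1.
rewrite quasi_coef_diag mul1r big1 ?add0r// => i _.
by rewrite hornerZ hornerXn expr0n subn_eq0 leqNgt ltn_ord/= mulr0.
Qed.

(** Differentiation with respect to the indeterminate lowers n by one. It stands in
    for the comparison of all the coefficients of the bracket. *)
Lemma deriv_quasi_poly s x n :
  (quasi_poly s x n)^`() = (n%:R * (s%:~R + n.-1%:R)) *: quasi_poly s x n.-1.
Proof.
case: n => [|n].
  by rewrite mul0r scale0r /quasi_poly big_ord_recl big_ord0 addr0 expr0 alg_polyC derivC.
rewrite /quasi_poly big_ord_recr/= subnn expr0 derivD alg_polyC derivC addr0.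
rewrite raddf_sum scaler_sumr; apply: eq_bigr => j _ /=.
rewrite derivZ derivXn subSn ?leq_ord// scalerA -scaler_nat scalerA.
congr (_ *: _); rewrite mulrAC -subSn ?leq_ord// quasi_coef_deriv ?leq_ord//.
exact: esym (mulrA _ _ _).
Qed.

Lemma deriv_eq0_const (p : {poly C}) : p^`() = 0 -> p = (p.[0])%:P.
Proof.
move=> p0; rewrite horner_coef0; apply/polyP => -[|i]; rewrite coefC//=.
have := congr1 (fun r : {poly C} => r`_i) p0; rewrite coef_deriv coef0.
by move/eqP; rewrite mulrn_eq0/= => /eqP.
Qed.

Definition rc_coef k l n j : C :=
  (-1) ^+ j * gbinomial R (k + n%:Z - 1) (n - j) * gbinomial R (l + n%:Z - 1) j.

Lemma rc_coef_telescope k l n i : (i < n)%N ->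
  rc_coef k l n i.+1 * (i.+1%:R * (k%:~R + i%:R)) +
  rc_coef k l n i * ((n - i)%:R * (l%:~R + (n - i.+1)%:R)) = 0.
Proof.
move=> jn; rewrite /rc_coef -(subnSK jn).
have g1 := gbinomialS (l + n%:Z - 1) i.
have g2 := gbinomialS (k + n%:Z - 1) (n - i.+1).
have nE : n%:R = (n - i.+1)%:R + i%:R + 1 :> C.
  by rewrite -[n in LHS](subnK jn) addnS -addn1 !natrD.
have e1 : (l + n%:Z - 1)%:~R - i%:R = l%:~R + (n - i.+1)%:R :> C.
  by rewrite rmorphB rmorphD/= -pmulrn nE; ring.
have e2 : (k + n%:Z - 1)%:~R - (n - i.+1)%:R = k%:~R + i%:R :> C.
  by rewrite rmorphB rmorphD/= -pmulrn nE; ring.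
rewrite e1 in g1; rewrite e2 in g2; rewrite exprS.
move: g1 g2; set a := gbinomial _ _ _; set b := gbinomial _ _ _.
set c := gbinomial _ _ _; set d := gbinomial _ _ _ => g1 g2.
set e := (-1) ^+ i; set u := i.+1%:R in g1 *; set v := (_.+1)%:R in g2 *.
rewrite [LHS](_ : _ = e * ((c * v) * (b * (l%:~R + (n - i.+1)%:R))
  - (d * (k%:~R + i%:R)) * (a * u))); last by ring.
by rewrite g1 g2 subrr mulr0.
Qed.

(** By [deriv_quasi_poly] and [rc_coef_telescope] the derivative of the left-hand
    side telescopes to 0, and the value at 0 of a quasi-polynomial is its constant
    term x n. This is the cancellation behind the modularity of the brackets: the
    powers of the cocycle disappear. *)
Lemma rc_quasi_poly k l x y n :
  \sum_(j < n.+1) rc_coef k l n j *: (quasi_poly k x j * quasi_poly l y (n - j)) =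
  (\sum_(j < n.+1) rc_coef k l n j * (x j * y (n - j)%N))%:P.
Proof.
set p := LHS.
have p0 : p.[0] = \sum_(j < n.+1) rc_coef k l n j * (x j * y (n - j)%N).
  rewrite horner_sum; apply: eq_bigr => j _.
  by rewrite hornerZ hornerM !horner0_quasi_poly.
rewrite -p0; apply: deriv_eq0_const.
rewrite /p raddf_sum/=; under eq_bigr => j _ do
  rewrite derivZ derivM !deriv_quasi_poly scalerDr.
rewrite big_split/= [X in _ + X]big_ord_recr [X in X + _]big_ord_recl/= subnn.
rewrite !(mul0r, mulr0, scale0r, scaler0, add0r, addr0).
rewrite -big_split/= big1// => i _; rewrite /bump/= add1n.
rewrite -scalerAl -scalerAr !scalerA -subnS -scalerDl rc_coef_telescope//.
by rewrite scale0r.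
Qed.
End Bracket.

(** * Derivatives of a slashed function *)

Section SlashChain.
Variable R : realType.
Local Notation C := (R[i]).
Implicit Types (tau : C) (f g : C -> C) (M : 'M[int]_2) (F : nat -> C -> C).
Local Notation H := (@upper_half_plane R).
Local Notation tpi := (two_pi_i R).

Lemma is_derive_sumc n (h : 'I_n -> C -> C) (dh : 'I_n -> C) tau :
  (forall i, is_derive (tau : C^o) 1 (h i : C^o -> C^o) (dh i)) ->
  is_derive (tau : C^o) 1 ((fun z => \sum_(i < n) h i z) : C^o -> C^o)
    (\sum_(i < n) dh i).
Proof.
move=> dH; rewrite (_ : (fun _ => _) = \sum_(i < n) (h i : C^o -> C^o)).
  exact: is_derive_sum.
by apply/funext => z; rewrite fct_sumE.
Qed.

Lemma horner_quasi_poly s (x : nat -> C) n (t : C) :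
  (quasi_poly s x n).[t] = \sum_(j < n.+1) quasi_coef R s n j * x j * t ^+ (n - j).
Proof.
by rewrite horner_sum; apply: eq_bigr => j _; rewrite hornerZ hornerXn.
Qed.

(** The shape in which the product rule delivers the derivative of the n-th
    quasi-polynomial. *)
Lemma quasi_poly_rec s (x : nat -> C) n (t : C) :
  (quasi_poly s x n.+1).[t] = \sum_(j < n.+1) quasi_coef R s n j *
     (t ^+ (n - j) * x j.+1 + (s%:~R + (n + j)%:R) * t ^+ (n - j).+1 * x j).
Proof.
rewrite horner_quasi_poly big_ord_recl/= subn0 quasi_coef0.
under eq_bigr => j _ do
  rewrite /bump/= add1n quasi_coefS ?leq_ord// subSS 2!mulrDl.
under [RHS]eq_bigr => j _ do rewrite mulrDr.
rewrite !big_split/= addrA addrC; congr (_ + _).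
  by apply: eq_bigr => j _; rewrite -mulrA [x _ * _]mulrC.
have -> : \sum_(i < n.+1) quasi_coef R s n i *
      ((s%:~R + (n + i)%:R) * t ^+ (n - i).+1 * x i) =
    \sum_(i < n.+2) quasi_coef R s n i *
      ((s%:~R + (n + i)%:R) * t ^+ (n.+1 - i) * x i).
  rewrite [RHS]big_ord_recr/= quasi_coef_small// mul0r addr0.
  by apply: eq_bigr => i _; rewrite subSn ?leq_ord.
rewrite [RHS]big_ord_recl/= addn0 subn0; congr (_ + _); first by ring.
by apply: eq_bigr => i _; rewrite /bump/= add1n subSS; ring.
Qed.

Definition slash_seq (s : int) F M tau (j : nat) : C :=
  slash (s + (2 * j)%N%:Z) (F j) M tau.

Definition slash_chain (s : int) F M (n : nat) tau : C :=
  (quasi_poly s (slash_seq s F M tau) n).[- cocycle M tau].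

Lemma slash_chain0 s F M tau : slash_chain s F M 0 tau = slash s (F 0%N) M tau.
Proof.
rewrite /slash_chain horner_quasi_poly big_ord_recl big_ord0 addr0 quasi_coef_diag.
by rewrite mul1r mulr1 /slash_seq muln0 addr0.
Qed.

(** The product rule gives
    D ((-w)^p X_j) = (-w)^p X_(j+1) + (p + s + 2j) (-w)^(p+1) X_j
    with X_j = (D^j f)|_(s+2j) M, which is [quasi_poly_rec]. *)
Lemma D_chain_slash s F M : \det M = 1 -> D_chain F ->
  D_chain (slash_chain s F M).
Proof.
move=> dM cF n tau t0.
have Mt := upper_half_plane_mobius dM t0.
rewrite (_ : slash_chain s F M n = fun z => \sum_(j < n.+1)
   (quasi_coef R s n j * slash_seq s F M z j) * (- cocycle M z) ^+ (n - j)); last first.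
  by apply/funext => z; rewrite /slash_chain horner_quasi_poly.
rewrite /slash_chain quasi_poly_rec mulr_sumr; apply: is_derive_sumc => j.
have dw := is_deriveN (is_derive_cocycle dM t0).
have dX := is_derive_slash (s + (2 * j)%N%:Z) dM t0 (cF j _ Mt).
have := is_deriveMc (is_deriveZc (quasi_coef R s n j) dX) (is_derive_exprn (n - j) dw).
congr (is_derive _ _ _ _) => /=.
have -> : slash (s + (2 * j)%N%:Z + 2) (F j.+1) M tau = slash_seq s F M tau j.+1.
  by rewrite /slash_seq (_ : s + _ + 2 = s + (2 * j.+1)%N%:Z)//; lia.
rewrite -/(slash_seq s F M tau j) opprK.
have -> : (s + (2 * j)%N%:Z)%:~R = s%:~R + j%:R + j%:R :> C.
  by rewrite rmorphD/= -pmulrn mul2n -addnn natrD addrA.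
have nE : (n + j)%:R = (n - j)%:R + j%:R + j%:R :> C.
  by rewrite -!natrD subnK ?leq_ord.
rewrite nE -[(- cocycle M) tau]/(- cocycle M tau).
case: (n - j)%N => [|m]; first by rewrite /= expr1 expr0; ring.
by rewrite /= !exprS; ring.
Qed.

(** A function that equals its slash has only one sequence of derivatives. *)
Lemma D_chain_invariant s F M : \det M = 1 -> D_chain F ->
  (forall z, H z -> slash s (F 0%N) M z = F 0%N z) ->
  forall n tau, H tau -> slash_chain s F M n tau = F n tau.
Proof.
move=> dM cF inv n tau t0.
rewrite -(D_chain_iter (D_chain_slash s dM cF) (f := F 0%N))//.
  by rewrite (D_chain_iter cF).
by move=> z zH; rewrite slash_chain0 inv.
Qed.
End SlashChain.

(** * Families with bounded finite sums *)

Section BoundedSums.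
Variable R : realType.

(** For a nonnegative family this is summability, in a form that passes through
    injections, products and termwise majorations without an enumeration. *)
Definition bounded_sums (I : choiceType) (B : I -> R) : Prop :=
  exists K, forall A : {fset I}, \sum_(i <- A) B i <= K.

Lemma ler_sum_sub_uniq (T : eqType) (s t : seq T) (B : T -> R) :
  (forall i, 0 <= B i) -> uniq s -> uniq t -> {subset s <= t} ->
  \sum_(i <- s) B i <= \sum_(i <- t) B i.
Proof.
move=> B0 us ut st.
rewrite [leRHS](bigID (mem s))/= -[leLHS]addr0 lerD ?sumr_ge0//.
rewrite -[leRHS]big_filter le_eqVlt; apply/orP; left; apply/eqP; apply: perm_big.
apply: uniq_perm; rewrite ?filter_uniq// => i.
by rewrite mem_filter; apply/idP/andP => [is_|[]//]; split => //; exact: st.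
Qed.

Lemma bounded_sums_le (I : choiceType) (B B' : I -> R) :
  (forall i, B i <= B' i) -> bounded_sums B' -> bounded_sums B.
Proof.
move=> BB [K BK]; exists K => A; apply: le_trans (BK A); exact: ler_sum.
Qed.

Lemma bounded_sumsZ (I : choiceType) (B : I -> R) a :
  0 <= a -> bounded_sums B -> bounded_sums (fun i => a * B i).
Proof.
move=> a0 [K BK]; exists (a * K) => A; rewrite -mulr_sumr; exact: ler_wpM2l.
Qed.

Lemma bounded_sums_sum (I : choiceType) n (B : 'I_n -> I -> R) :
  (forall j, bounded_sums (B j)) -> bounded_sums (fun i => \sum_(j < n) B j i).
Proof.
move=> /choice[K BK]; exists (\sum_(j < n) K j) => A.
by rewrite exchange_big/=; apply: ler_sum => j _; exact: BK.
Qed.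

Lemma bounded_sums_uniq (I : choiceType) (B : I -> R) : bounded_sums B ->
  exists K, forall s, uniq s -> \sum_(i <- s) B i <= K.
Proof.
move=> [K BK]; exists K => s us; apply: le_trans (BK [fset i in s]%fset).
rewrite le_eqVlt; apply/orP; left; apply/eqP; apply: perm_big.
apply: uniq_perm; rewrite ?fset_uniq// => i.
by rewrite in_fset.
Qed.

Lemma bounded_sums_inj (I J : choiceType) (r : I -> J) (B : J -> R) :
  injective r -> bounded_sums B -> bounded_sums (B \o r).
Proof.
move=> rI /bounded_sums_uniq[K BK]; exists K => A.
have := BK (map r A); rewrite big_map; apply.
by rewrite map_inj_uniq ?fset_uniq.
Qed.

(** A finite set of pairs lies in the product of its projections. *)
Lemma bounded_sums_prod (I J : choiceType) (B : I -> R) (B' : J -> R) :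
  (forall i, 0 <= B i) -> (forall i, 0 <= B' i) ->
  bounded_sums B -> bounded_sums B' ->
  bounded_sums (fun p : I * J => B p.1 * B' p.2).
Proof.
move=> B0 B'0 /bounded_sums_uniq[K BK] /bounded_sums_uniq[K' BK'].
exists (K * K') => A.
pose s := undup (map fst A); pose t := undup (map snd A).
apply: le_trans (_ : \sum_(p <- [seq (i, j) | i <- s, j <- t]) B p.1 * B' p.2 <= _).
  apply: ler_sum_sub_uniq; rewrite ?fset_uniq//.
  - by move=> p; rewrite mulr_ge0.
  - by rewrite allpairs_uniq ?undup_uniq// => -[? ?] [].
  - move=> [i j] ijA; apply/allpairsP; exists (i, j).
    by rewrite !mem_undup; split => //; [exact: (map_f fst ijA)|exact: (map_f snd ijA)].
rewrite big_allpairs/=; under eq_bigr => i _ do rewrite -mulr_sumr.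
rewrite -mulr_suml ler_pM ?sumr_ge0//; [exact/BK/undup_uniq|exact/BK'/undup_uniq].
Qed.

(** The induction is run on the sharper bound 2 - 1/N, which telescopes. *)
Lemma sum_inv_sqr_le2 N : \sum_(0 <= n < N) (n.+1%:R ^- 2 : R) <= 2.
Proof.
apply: le_trans (_ : \sum_(0 <= n < N.+1) (n.+1%:R ^- 2 : R) <= _).
  by rewrite big_nat_recr//= lerDl invr_ge0 exprn_ge0.
(* The extra summand makes the sharper bound start at N = 1. *)
apply: le_trans (_ : 2 - N.+1%:R^-1 <= _); last by rewrite gerBl.
elim: N => [|N IH]; first by rewrite big_nat1 expr1n invr1; lra.
rewrite big_nat_recr//=; apply: le_trans (lerD IH (lexx _)) _.
rewrite -addrA lerD2l.
have -> : N.+2%:R = N.+1%:R + 1 :> R by rewrite -natr1.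
have : 0 < N.+1%:R :> R by [].
move: (N.+1%:R : R) => x x0.
rewrite -subr_ge0.
have -> : - (x + 1)^-1 - (- x^-1 + (x + 1) ^- 2) = (x * (x + 1) ^+ 2)^-1.
  by field; apply/andP; split; apply/eqP; lra.
by rewrite invr_ge0 mulr_ge0 ?exprn_ge0// ?addr_ge0// ltW.
Qed.

Lemma bounded_sums_inv_sqr : bounded_sums (fun n : nat => n.+1%:R ^- 2 : R).
Proof.
exists 2 => A.
apply: le_trans (sum_inv_sqr_le2 (\max_(n <- A) n).+1).
apply: ler_sum_sub_uniq; rewrite ?fset_uniq ?iota_uniq//.
move=> n nA; rewrite mem_index_iota/= ltnS.
by rewrite (@leq_bigmax_seq _ _ xpredT id).
Qed.

Lemma bounded_sums_int : bounded_sums (fun c : int => (`|c|%N.+1)%:R ^- 2 : R).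
Proof.
pose r (c : int) : nat * bool :=
  match c with Posz n => (n, true) | Negz n => (n, false) end.
have rI : injective r by case=> [n|n] [m|m] [->].
apply: (@bounded_sums_le _ _ ((fun p : nat * bool => p.1.+1%:R ^- 2 * 1) \o r)).
  case=> n /=; rewrite mulr1// lef_pV2 ?posrE ?exprn_gt0//.
  by rewrite lerXn2r ?nnegrE// ler_nat.
apply: bounded_sums_inj rI _.
apply: (@bounded_sums_prod _ _ (fun n : nat => n.+1%:R ^- 2) (fun=> 1)) => //.
  exact: bounded_sums_inv_sqr.
exists 2 => A; rewrite (le_trans (ler_sum_sub_uniq (t := [:: true; false]) _ _ _ _))//.
- exact: fset_uniq.
- by case.
- by rewrite !big_cons big_nil; lra.
Qed.

Lemma bounded_sums_summable (I : choiceType) (B : I -> R) (t : I -> R[i]) :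
  (forall i, normc (t i) <= B i) -> bounded_sums B ->
  summable [set: I] (fun i => (complex.Re `|t i|)%:E).
Proof.
move=> tB [K BK]; rewrite /summable /esum.
apply: (@le_lt_trans _ _ K%:E); last exact: ltry.
apply: ge_ereal_sup => _ [A [finA _] <-].
rewrite fsbig_finite//=.
rewrite (eq_bigr (fun i => (normc (t i))%:E)) => [|i _]; last first.
  by rewrite ger0_norm ?normc_ge0.
rewrite sumEFin lee_fin; apply: le_trans (BK (fset_set A)).
by apply: ler_sum => i _; exact: tB.
Qed.

End BoundedSums.

(** * Unordered sums and termwise differentiation *)

Section UnorderedSums.
Variables (R : realType) (I : choiceType).
Local Notation C := (R[i]).
Implicit Types (f g : I -> C) (B : I -> R) (A : {fset I}).

(** Convergence along the net of finite sets, unfolded. *)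
Definition has_sum f (s : C) : Prop := forall e : R, 0 < e ->
  exists A0, forall A, (A0 `<=` A)%fset -> normc (s - \sum_(i <- A) f i) <= e.

Lemma has_sum_summability f s : has_sum f s ->
  summability.sum (f : I -> C^o) = s.
Proof.
move=> fs.
have FF : ProperFilter (@summability.totally I) := summability.totally_filter.
have cv : summability.partial_sum (f : I -> C^o) @ summability.totally --> (s : C^o).
  apply/cvgrPdist_le => e e0.
  have eE : e = (complex.Re e)%:C%C by rewrite RRe_real// gtr0_real.
  have [|A0 HA] := fs (complex.Re e); first by rewrite -ltcR -eE.
  exists A0 => // A /= /HA; rewrite /summability.partial_sum.
  rewrite (big_seq_fsetE _ _ xpredT)/=.
  by rewrite -lecR -eE.
exact/(cvg_lim (@norm_hausdorff _ _)).
Qed.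

Lemma has_sumD f g s t : has_sum f s -> has_sum g t ->
  has_sum (fun i => f i + g i) (s + t).
Proof.
move=> fs gt e e0; have e2 : 0 < e / 2 by rewrite divr_gt0.
have [A1 H1] := fs _ e2; have [A2 H2] := gt _ e2.
exists (A1 `|` A2)%fset => A; rewrite fsubUset => /andP[/H1 h1 /H2 h2].
rewrite big_split/= opprD addrACA (splitr e).
by apply: le_trans (le_normcD _ _) _; exact: lerD.
Qed.

Lemma has_sumZ f s a : has_sum f s -> has_sum (fun i => a * f i) (a * s).
Proof.
move=> fs e e0.
have a0 : 0 < normc a + 1 by rewrite ltr_wpDl// normc_ge0.
have [|A0 H0] := fs (e / (normc a + 1)); first by rewrite divr_gt0.
exists A0 => A /H0 h; rewrite -mulr_sumr -mulrBr normcM.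
apply: le_trans (ler_pM (normc_ge0 _) (normc_ge0 _) _ h) (_ : (normc a + 1) * _ <= _).
  by rewrite lerDl.
by rewrite mulrC divfK// gt_eqF.
Qed.

Lemma has_sum0 : has_sum (fun=> 0) 0.
Proof.
by move=> e e0; exists fset0%fset => A _; rewrite big1// subrr normc0 ltW.
Qed.

Lemma has_sum_sum n (f : 'I_n -> I -> C) (s : 'I_n -> C) :
  (forall j, has_sum (f j) (s j)) ->
  has_sum (fun i => \sum_(j < n) f j i) (\sum_(j < n) s j).
Proof.
elim: n f s => [|n IH] f s fs.
  rewrite big_ord0 (_ : (fun _ => _) = fun=> 0); first exact: has_sum0.
  by apply/funext => i; rewrite big_ord0.
rewrite big_ord_recl (_ : (fun _ => _) = fun i =>
  f ord0 i + \sum_(j < n) f (lift ord0 j) i); last first.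
  by apply/funext => i; rewrite big_ord_recl.
by apply: has_sumD => //; apply: IH.
Qed.

Lemma eq_has_sum f g s : f =1 g -> has_sum f s -> has_sum g s.
Proof. by move=> /funext ->. Qed.

Lemma has_sum_normc_le f s K : has_sum f s ->
  (forall A, \sum_(i <- A) normc (f i) <= K) -> normc s <= K.
Proof.
move=> fs fK; apply/ler_addgt0Pr => e e0.
have [A /(_ A (fsubset_refl A)) H] := fs e e0.
rewrite -(subrK (\sum_(i <- A) f i) s) addrC.
apply: le_trans (le_normcD _ _) _; apply: lerD => //.
exact: le_trans (normc_sum _ _) (fK A).
Qed.

Lemma has_sum_ge0 B : (forall i, 0 <= B i) -> bounded_sums B ->
  exists s, has_sum (fun i => (B i)%:C%C) s.
Proof.
move=> B0 [K BK].
pose E : set R := [set x | exists A, x = \sum_(i <- A) B i].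
have supE : has_sup E.
  split; first by exists (\sum_(i <- fset0%fset) B i), fset0%fset.
  by exists K => _ [A ->].
exists (sup E)%:C%C => e e0.
have [_ [A0 ->] lt] := sup_adherent e0 supE.
exists A0 => A AA.
rewrite (_ : _ - _ = (sup E - \sum_(i <- A) B i)%:C%C); last first.
  by rewrite rmorphB rmorph_sum.
rewrite normc_real.
have u : \sum_(i <- A) B i <= sup E by apply: sup_upper_bound supE _ _; exists A.
rewrite ger0_norm ?subr_ge0// lerBlDr -lerBlDl.
apply: le_trans (ltW lt) _.
by apply: ler_sum_sub_uniq; rewrite ?fset_uniq//; exact/fsubsetP.
Qed.

(** The real and imaginary parts u satisfy |u| <= B, and u = (u + B) - B is a
    difference of nonnegative families, whose finite sums converge to their
    supremum. *)
Lemma has_sum_dominated f B : (forall i, normc (f i) <= B i) ->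
  bounded_sums B -> exists s, has_sum f s.
Proof.
move=> fB bB.
have B0 i : 0 <= B i by exact: le_trans (normc_ge0 _) (fB i).
have [sB hB] := has_sum_ge0 B0 bB.
have part (u : I -> R) : (forall i, `|u i| <= B i) ->
    exists s, has_sum (fun i => (u i)%:C%C) s.
  move=> uB.
  have [||s hs] := @has_sum_ge0 (fun i => u i + B i).
  - by move=> i; have := uB i; rewrite ler_norml lerNl => /andP[+ _]; lra.
  - have [K BK] := bB; exists (K + K) => A; rewrite big_split/= lerD//.
    apply: le_trans (BK A); apply: ler_sum => i _.
    exact: le_trans (ler_norm _) (uB i).
  exists (s + (-1) * sB); apply: eq_has_sum (has_sumD hs (has_sumZ (-1) hB)).
  by move=> i /=; rewrite rmorphD/= mulN1r addrK.
have [|s1 h1] := part (fun i => complex.Re (f i)).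
  by move=> i; exact: le_trans (ler_normc_Re _) (fB i).
have [|s2 h2] := part (fun i => complex.Im (f i)).
  by move=> i; exact: le_trans (ler_normc_Im _) (fB i).
exists (s1 + 'i%C * s2); apply: eq_has_sum (has_sumD h1 (has_sumZ 'i%C h2)).
by move=> i; rewrite -complexE.
Qed.

Local Notation H := (@upper_half_plane R).
Local Notation tpi := (two_pi_i R).

Definition locally_dominated (u : I -> C -> C) : Prop := forall tau, H tau ->
  exists2 d : R, 0 < d & exists2 B, bounded_sums B &
    forall i h, normc h < d -> normc (u i (tau + h)) <= B i.

Lemma locally_dominated_has_sum u tau : locally_dominated u -> H tau ->
  has_sum (fun i => u i tau) (summability.sum (fun i => u i tau : C^o)).
Proof.
move=> du t0; have [d d0 [B bB uB]] := du tau t0.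
have [|s hs] := @has_sum_dominated (fun i => u i tau) B _ bB.
  by move=> i; have := uB i 0; rewrite addr0 normc0; exact.
by rewrite (has_sum_summability hs).
Qed.

(** Domination of the (n+2)-nd derivatives bounds the first-order Taylor remainders
    of the n-th ones by |h|^2 times summable constants, for h in a disc independent
    of i. Requiring domination at every order replaces Cauchy's integral formula. *)
Lemma D_chain_sum (u : nat -> I -> C -> C) :
  (forall i, D_chain (fun n => u n i)) -> (forall n, locally_dominated (u n)) ->
  D_chain (fun n tau => summability.sum (fun i => u n i tau : C^o)).
Proof.
move=> cu du n tau t0.
have [d d0 [B [K BK] uB]] := du n.+2 tau t0.
apply: (@is_derive_quadratic _ _ _ _ (Num.min d (complex.Im tau))
    (16 * (normc (tpi ^+ 2) * K))) => [|h].
  by rewrite lt_min d0.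
rewrite lt_min => /andP[hd ht].
have th : H (tau + h) by exact: upper_half_plane_disc.
have hS := locally_dominated_has_sum (du n) th.
have hT := locally_dominated_has_sum (du n) t0.
have hU := locally_dominated_has_sum (du n.+1) t0.
have := has_sumD (has_sumD hS (has_sumZ (-1) hT)) (has_sumZ (- (h * tpi)) hU).
rewrite mulN1r mulNr -[h * tpi * _]mulrA => /has_sum_normc_le; apply => A.
apply: le_trans (_ : \sum_(i <- A) 16 * (normc (tpi ^+ 2) * B i) * normc h ^+ 2 <= _).
  apply: ler_sum => i _.
  rewrite (_ : _ + _ + _ = u n i (tau + h) - u n i tau - h * (tpi * u n.+1 i tau));
    last by ring.
  apply: (taylor1_bound (f' := fun z => tpi * u n.+1 i z)
                        (f'' := fun z => tpi ^+ 2 * u n.+2 i z)) => k kh.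
  - by apply: cu; apply: upper_half_plane_disc => //; exact: le_lt_trans kh _.
  - rewrite expr2 -mulrA; apply: is_deriveZc; apply: cu.
    by apply: upper_half_plane_disc => //; exact: le_lt_trans kh _.
  - rewrite normcM ler_wpM2l ?normc_ge0//; apply: uB; exact: le_lt_trans kh _.
rewrite -mulr_suml -!mulr_sumr ler_wpM2r ?exprn_ge0 ?normc_ge0//.
by rewrite !ler_wpM2l ?normc_ge0.
Qed.

End UnorderedSums.

(** * Fourier expansions *)

Section Fourier.
Variable R : realType.
Local Notation C := (R[i]).
Local Notation H := (@upper_half_plane R).

Lemma has_sum_series (f : nat -> C) (B : nat -> R) (l : C) :
  (forall n, normc (f n) <= B n) -> bounded_sums B ->
  series (f : nat -> C^o) @ \oo --> (l : C^o) -> has_sum f l.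
Proof.
move=> fB bB fl; have [s fs] := has_sum_dominated fB bB.
suff sl : series (f : nat -> C^o) @ \oo --> (s : C^o).
  by rewrite (_ : l = s)//; exact: (cvg_unique (@norm_hausdorff _ _) fl sl).
apply/cvgrPdist_le => e e0.
have eE : e = (complex.Re e)%:C%C by rewrite RRe_real// gtr0_real.
have [|A0 HA] := fs (complex.Re e); first by rewrite -ltcR -eE.
near=> N.
have /HA : (A0 `<=` [fset n in iota 0 N])%fset.
  apply/fsubsetP => n nA; rewrite in_fset/= mem_iota/= add0n.
  apply: leq_trans (_ : (\max_(n <- A0) n).+1 <= N)%N.
    by rewrite ltnS (@leq_bigmax_seq _ _ xpredT id).
  by near: N; exact: nbhs_infty_ge.
rewrite (perm_big (index_iota 0 N))/=; last first.
  apply: uniq_perm; rewrite ?fset_uniq ?iota_uniq// => n.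
  by rewrite in_fset/= /index_iota subn0.
by rewrite seriesEnat/= -lecR -eE.
Unshelve. all: by end_near. Qed.

(** The exponential is cut into j + 2 equal factors, each of which absorbs one
    factor n + 1. *)
Lemma expR_poly_decay (x : R) (j : nat) : 0 < x ->
  exists2 K, 0 <= K & forall n, n%:R ^+ j * expR (- x) ^+ n <= K * n.+1%:R ^- 2.
Proof.
move=> x0; pose e := x / j.+2%:R.
have e0 : 0 < e by rewrite divr_gt0.
exists ((1 + e^-1) ^+ j.+2) => [|n].
  by rewrite exprn_ge0// addr_ge0// invr_ge0 ltW.
rewrite ler_pdivlMr ?exprn_gt0//.
have -> : expR (- x) ^+ n = expR (- (e *+ n)) ^+ j.+2.
  rewrite -!expRM_natl; congr expR; rewrite /e -mulr_natl.
  have c0 : j.+2%:R != 0 :> R by rewrite pnatr_eq0.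
  by move: (j.+2%:R : R) c0 => c c0; field.
apply: le_trans (_ : (n.+1%:R * expR (- (e *+ n))) ^+ j.+2 <= _).
  rewrite exprMn mulrAC ler_wpM2r ?exprn_ge0 ?expR_ge0//.
  rewrite -[j.+2]addn2 exprD ler_wpM2r ?exprn_ge0// lerXn2r ?nnegrE//.
  by rewrite ler_nat.
have le1 : n.+1%:R * expR (- (e *+ n)) <= 1 + e^-1.
  rewrite expRN ler_pdivrMr ?expR_gt0//.
  apply: le_trans (_ : (1 + e^-1) * (1 + e *+ n) <= _); last first.
    by rewrite ler_wpM2l ?expR_ge1Dx// addr_ge0// invr_ge0 ltW.
  have -> : (1 + e^-1) * (1 + e *+ n) = n.+1%:R + (e^-1 + e *+ n).
    by rewrite -mulr_natl -natr1; field; exact: lt0r_neq0.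
  by rewrite lerDl addr_ge0 ?mulrn_wge0 ?invr_ge0 ?ltW.
rewrite lerXn2r// nnegrE; last by rewrite addr_ge0// invr_ge0 ltW.
by rewrite mulr_ge0// expR_ge0.
Qed.

Lemma D_chainZ (a : C) (F : nat -> C -> C) :
  D_chain F -> D_chain (fun n tau => a * F n tau).
Proof.
by move=> cF n tau t0; rewrite mulrCA; apply: is_deriveZc; exact: cF.
Qed.

Lemma normc_q (tau : C) : normc (q tau) = expR (- (2 * pi * complex.Im tau)).
Proof.
by rewrite normc_cexp; case: tau => x y /=; congr expR; ring.
Qed.

(** With y = Im tau, convergence at i y / 4 makes a_n e^(-2 pi n y / 4) bounded,
    while |q|^n <= e^(-2 pi n y / 2) near tau. The surplus exponential absorbs the
    powers of n brought by D, so the expansion can be differentiated termwise at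
    every order. *)
Lemma fourier_chain (a : nat -> C) (f : C -> C) : fourier_expansion a f ->
  exists2 F, D_chain F & forall tau, H tau -> f tau = F 0%N tau.
Proof.
move=> fa.
pose u j n tau : C := a n * (n%:R ^+ j * q tau ^+ n).
have du j : locally_dominated (u j).
  move=> tau t0; set y := complex.Im tau; pose x := 2 * pi * (y / 4).
  have y0 : 0 < y by [].
  have x0 : 0 < x by rewrite !mulr_gt0 ?pi_gt0 ?divr_gt0.
  have tH : H (0 +i* (y / 4))%C by rewrite /upper_half_plane/= divr_gt0.
  have [A A0 aA] : exists2 A, 0 <= A & forall n, normc (a n) * expR (- x) ^+ n <= A.
    have /cvgP/cvg_series_cvg_0/cvgP/cvg_seq_bounded := fa _ tH.
    move=> /pinfty_ex_gt0[A A0 aA].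
    have AE : A = (complex.Re A)%:C%C by rewrite RRe_real// gtr0_real.
    exists (complex.Re A) => [|n]; first by rewrite -lecR -AE ltW.
    rewrite -lecR -AE.
    have -> : expR (- x) = normc (q (0 +i* (y / 4))%C) by rewrite normc_q.
    by rewrite -normcX -normcM; exact: aA.
  have [K K0 xK] := expR_poly_decay j x0.
  exists (y / 2); first by rewrite divr_gt0.
  exists (fun n => A * K * n.+1%:R ^- 2).
    by apply: bounded_sumsZ (bounded_sums_inv_sqr R); rewrite mulr_ge0.
  move=> n h hy; rewrite /u 2!normcM !normcX normc_nat.
  have qx : normc (q (tau + h)) <= expR (- x) * expR (- x).
    rewrite normc_q -expRD ler_expR.
    have : y / 2 <= complex.Im (tau + h).
      have := le_lt_trans (ler_normc_Im h) hy; rewrite ltr_norml => /andP[+ _].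
      by rewrite /y; case: (tau) (h) => [? ?] [? ?] /=; lra.
    rewrite /x => hh; rewrite -opprD lerN2.
    have := pi_gt0 R; nra.
  apply: le_trans (_ : (normc (a n) * expR (- x) ^+ n) *
                       (n%:R ^+ j * expR (- x) ^+ n) <= _).
    rewrite [leRHS](_ : _ = normc (a n) * (n%:R ^+ j * (expR (- x) * expR (- x)) ^+ n)).
      rewrite !ler_wpM2l ?normc_ge0 ?exprn_ge0//.
      by rewrite lerXn2r ?nnegrE ?mulr_ge0 ?expR_ge0 ?normc_ge0.
    by rewrite exprMn; ring.
  by rewrite -[leRHS]mulrA ler_pM ?mulr_ge0 ?normc_ge0 ?exprn_ge0 ?expR_ge0.
exists (fun j tau => summability.sum (fun n => u j n tau : C^o)).
  by apply: D_chain_sum => // n; apply: D_chainZ; exact: D_chain_qpow.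
move=> tau t0; apply/esym/has_sum_summability.
have [d d0 [B bB uB]] := du 0%N tau t0.
apply: has_sum_series bB _ => [n|].
  by have := uB n 0; rewrite addr0; apply; rewrite normc0.
rewrite (_ : (fun n => _) = (fun n => a n * q tau ^+ n)); first exact: fa.
by apply/funext => n; rewrite /u expr0 mul1r.
Qed.
End Fourier.

(** * Cosets and bottom rows *)

Section Cosets.
Implicit Types M : 'M[int]_2.

Definition unipotent (t : int) : 'M[int]_2 :=
  \matrix_(i < 2, j < 2) (if (i == j) then 1 else if (i < j)%N then t else 0).

Lemma mulmx2E M M' i j : (M * M') i j = M i 0 * M' 0 j + M i 1 * M' 1 j.
Proof.
rewrite -[M * M']/(M *m M') mxE !big_ord_recl big_ord0 addr0.
by have -> : lift ord0 ord0 = 1 :> 'I_2 by apply/val_inj.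
Qed.

Lemma matrix2P M M' : M 0 0 = M' 0 0 -> M 0 1 = M' 0 1 -> M 1 0 = M' 1 0 ->
  M 1 1 = M' 1 1 -> M = M'.
Proof.
move=> h1 h2 h3 h4; apply/matrixP => i j.
have I2 (k : 'I_2) : k = 0 \/ k = 1.
  by case: k => [[|[|//]] h]; [left|right]; apply/val_inj.
by case: (I2 i) (I2 j) => -> [] ->.
Qed.

Lemma unipotentD t s : unipotent t * unipotent s = unipotent (t + s).
Proof. by apply: matrix2P; rewrite mulmx2E !mxE /=; ring. Qed.

Lemma Gamma_infty_unipotent t : Gamma_infty (unipotent t).
Proof.
have T1 : unipotent 1 = Tmx by apply: matrix2P; rewrite !mxE.
have T0 : unipotent 0 = 1 by apply: matrix2P; rewrite !mxE.
have Gn (n : nat) : Gamma_infty (unipotent n).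
  elim: n => [|n IH]; first by rewrite T0; exact: Gamma_infty1.
  rewrite -addn1 PoszD -unipotentD T1; apply: Gamma_inftyM => //.
  exact: Gamma_inftyT.
case: t => n //.
have -> : unipotent (Negz n) = (unipotent n.+1)^-1.
  have U : unipotent n.+1 \is a GRing.unit.
    apply/unitrP; exists (unipotent (- n.+1%:Z)).
    by rewrite !unipotentD addNr addrN T0.
  by rewrite -(mulKr U (unipotent (Negz n))) unipotentD NegzE addrN T0 mulr1.
exact: Gamma_inftyV.
Qed.

Lemma det_SL2Z (M : SL2Z) : \det (val M) = 1.
Proof. exact/eqP/(valP M). Qed.

(** Both determinants are 1, so the difference of the top rows is a multiple t of
    the common bottom row (c, d); pairing with the top row (a, b) gives
    t = a (b' - b) - b (a' - a). *)
Lemma same_coset_bottom_row (M M' : SL2Z) :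
  val M 1 0 = val M' 1 0 -> val M 1 1 = val M' 1 1 -> same_coset M M'.
Proof.
have := det2 (det_SL2Z M); have := det2 (det_SL2Z M').
set a := val M' 0 0; set b := val M' 0 1; set c := val M' 1 0; set d := val M' 1 1.
set a' := val M 0 0; set b' := val M 0 1.
move=> e1 e2 ec ed; rewrite ec ed in e2; apply/asboolP.
exists (unipotent (a * (b' - b) - b * (a' - a))).
  exact: Gamma_infty_unipotent.
apply: matrix2P; rewrite mulmx2E !mxE /= -/a -/b -/c -/d -/a' -/b'.
- have -> : 1 * a + (a * (b' - b) - b * (a' - a)) * c =
    a + (a' - a) * (a * d - b * c) - a * ((a' * d - b' * c) - (a * d - b * c)).
    by ring.
  by rewrite e1 e2; ring.
- have -> : 1 * b + (a * (b' - b) - b * (a' - a)) * d =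
    b + (b' - b) * (a * d - b * c) - b * ((a' * d - b' * c) - (a * d - b * c)).
    by ring.
  by rewrite e1 e2; ring.
- by rewrite ec; ring.
- by rewrite ed; ring.
Qed.

Definition bottom_row (x : cosets) : int * int :=
  (val (repr x) 1 0, val (repr x) 1 1).

Lemma bottom_row_inj : injective bottom_row.
Proof.
move=> x y [e1 e2].
have := same_coset_bottom_row e1 e2.
rewrite -[same_coset _ _]/(same_coset_equiv _ _) => /eqmodP.
by rewrite !reprK.
Qed.

Definition height M : nat := (`|M 1%R 0%R| + `|M 1%R 1%R|)%N.

Lemma height_gt0 M : \det M = 1 -> (0 < height M)%N.
Proof.
move=> /det2 dM; rewrite lt0n addn_eq0 !absz_eq0.
apply/negP => /andP[/eqP c0 /eqP d0].
by move: dM; rewrite c0 d0 !mulr0.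
Qed.
End Cosets.

(** * Convergence of the Poincare series and its derivatives *)

Section Poincare.
Variable R : realType.
Local Notation C := (R[i]).
Local Notation H := (@upper_half_plane R).
Local Notation tpi := (two_pi_i R).
Implicit Types (M : 'M[int]_2) (tau : C).

(** A coset is determined by its bottom row (c, d), and since |c| + |d| >= 1, both
    |c| + 1 and |d| + 1 are at most 2 (|c| + |d|); hence
    (|c| + |d|)^-4 <= 16 (|c| + 1)^-2 (|d| + 1)^-2. *)
Lemma bounded_sums_coset : bounded_sums (fun x : cosets =>
  (height (val (repr x)))%:R ^- 4 : R).
Proof.
have g0 (c : int) : 0 <= (`|c|%N.+1)%:R ^- 2 :> R by rewrite invr_ge0 exprn_ge0.
have B := bounded_sums_inj bottom_row_inj
  (bounded_sums_prod g0 g0 (bounded_sums_int R) (bounded_sums_int R)).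
apply: bounded_sums_le (bounded_sumsZ (_ : 0 <= 16) B) => // x /=.
have := height_gt0 (det_SL2Z (repr x)).
rewrite /height /=; move: (`|_|)%N (`|_|)%N => d c cd.
have : (1 : R) <= (c + d)%:R by rewrite ler1n.
rewrite -[c.+1%:R]natr1 -[d.+1%:R]natr1 natrD.
have : 0 <= (c%:R : R) by []. have : 0 <= (d%:R : R) by [].
move: (c%:R : R) (d%:R : R) => u v v0 u0 uv.
have half (w w' : R) : 0 <= w -> 0 <= w' -> 1 <= w + w' ->
    (w + w') ^- 2 <= 4 * (w + 1) ^- 2.
  move=> w0 w'0 ww; have p1 : 0 < w + w' by exact: lt_le_trans ww.
  have p2 : 0 < w + 1 by rewrite ltr_wpDl.
  rewrite ler_pdivlMr ?exprn_gt0// mulrC ler_pdivrMr ?exprn_gt0//.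
  have -> : 4 * (w + w') ^+ 2 = (2 * (w + w')) ^+ 2 by ring.
  by rewrite lerXn2r ?nnegrE; lra.
have -> : (u + v) ^- 4 = (u + v) ^- 2 * (u + v) ^- 2.
  by rewrite -invfM -exprD.
have -> : 16 * ((u + 1) ^- 2 * (v + 1) ^- 2) = (4 * (u + 1) ^- 2) * (4 * (v + 1) ^- 2).
  by ring.
apply: ler_pM; rewrite ?invr_ge0 ?exprn_ge0 ?addr_ge0//; first exact: half.
by rewrite addrC half// addrC.
Qed.

(** The imaginary part of c tau + d bounds |c|, and then its real part bounds |d|.
    Neither bound depends on M, and both are uniform near tau. *)
Lemma den_lower_bound tau : H tau -> exists2 e : R, 0 < e <= 1 &
  forall M h, normc h < complex.Im tau / 2 ->
    e * (height M)%:R <= normc (den M (tau + h)).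
Proof.
move=> t0; set y := complex.Im tau; pose X := `|complex.Re tau| + y / 2.
have y0 : 0 < y by [].
have X0 : 0 <= X by rewrite addr_ge0// ltW// divr_gt0.
pose K := 1 + (1 + X) * (2 / y).
have K1 : 1 <= K by rewrite lerDl mulr_ge0 ?addr_ge0// ltW// divr_gt0.
have K0 : 0 < K by exact: lt_le_trans K1.
exists K^-1 => [|M h hy].
  by rewrite invr_gt0 K0 invf_le1.
rewrite mulrC ler_pdivrMr// /height natrD !natr_absz !intr_norm.
have := ler_normc_Im (den M (tau + h)); have := ler_normc_Re (den M (tau + h)).
rewrite Im_den Re_den; set n := normc _ => hr hi.
have yh : y / 2 <= complex.Im (tau + h).
  have := le_lt_trans (ler_normc_Im h) hy; rewrite ltr_norml => /andP[+ _].
  by rewrite /y; case: (tau) (h) => [? ?] [? ?] /=; lra.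
have xh : `|complex.Re (tau + h)| <= X.
  have -> : complex.Re (tau + h) = complex.Re tau + complex.Re h.
    by case: (tau) (h) => [? ?] [? ?].
  rewrite (le_trans (ler_normD _ _))// lerD2l.
  by rewrite (le_trans (ler_normc_Re h))// ltW.
set c : R := (M 1 0)%:~R in hr hi *; set d : R := (M 1 1)%:~R in hr *.
have n0 : 0 <= n by exact: normc_ge0.
have cn : `|c| <= n * (2 / y).
  have y2 : 0 < y / 2 by rewrite divr_gt0.
  have -> : 2 / y = (y / 2)^-1 by rewrite invf_div.
  rewrite ler_pdivlMr//; apply: le_trans hi; rewrite normrM ler_wpM2l//.
  exact: le_trans (ler_norm _).
have dn : `|d| <= n + `|c| * X.
  rewrite -(addKr (c * complex.Re (tau + h)) d) addrC.
  rewrite (le_trans (ler_normD _ _))// lerD// normrN normrM.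
  by rewrite ler_wpM2l.
rewrite /K mulrDr mulr1 [(1 + X) * _]mulrC mulrA mulrDr mulr1.
have : `|c| * X <= n * (2 / y) * X by rewrite ler_wpM2r.
by move: cn dn; move: (n * (2 / y)) => p; lra.
Qed.

Lemma normc_q_le1 tau : H tau -> normc (q tau) <= 1.
Proof.
move=> t0; rewrite normc_q -[leRHS](expR0 R) ler_expR oppr_le0.
by rewrite !mulr_ge0 ?pi_ge0// ltW.
Qed.

Definition qpow_chain (N : nat) (n : nat) tau : C := N%:R ^+ n * q tau ^+ N.

(** |q| <= 1 on the half-plane, so only the automorphy factor contributes; its
    exponent l + 2 j is at least 4, the exponent of [bounded_sums_coset]. *)
Lemma normc_slash_qpow (l N j : nat) M tau (e : R) : (4 <= l)%N ->
  \det M = 1 -> H tau -> 0 < e <= 1 -> e * (height M)%:R <= normc (den M tau) ->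
  normc (slash_seq l (qpow_chain N) M tau j) <=
    N%:R ^+ j * e ^- (l + 2 * j) * (height M)%:R ^- 4.
Proof.
move=> l4 dM t0 /andP[e0 e1] He.
have h0 : (0 < height M)%N by exact: height_gt0.
have h1 : (1 : R) <= (height M)%:R by rewrite ler1n.
have p0 : 0 < normc (den M tau) by rewrite normc_gt0// den_neq0.
rewrite /slash_seq slashE /qpow_chain !normcM normcXz !normcX normc_nat -PoszD.
rewrite -exprnN mulrCA -mulrA ler_wpM2l ?exprn_ge0//.
apply: le_trans (_ : normc (den M tau) ^- (l + 2 * j) <= _).
  rewrite ler_piMr ?invr_ge0 ?exprn_ge0 ?normc_ge0//.
  by rewrite exprn_ile1 ?normc_ge0// normc_q_le1//; exact: upper_half_plane_mobius.
apply: le_trans (_ : (e * (height M)%:R) ^- (l + 2 * j) <= _).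
  rewrite lef_pV2 ?posrE ?exprn_gt0//; last by rewrite mulr_gt0// ltr0n.
  by rewrite lerXn2r ?nnegrE ?normc_ge0// mulr_ge0// ltW.
rewrite exprMn invfM ler_wpM2l ?invr_ge0 ?exprn_ge0 ?(ltW e0)//.
rewrite lef_pV2 ?posrE ?exprn_gt0 ?ltr0n//.
by rewrite ler_weXn2l// (leq_trans l4)// leq_addr.
Qed.

Lemma normc_cocycle M tau (e : R) :
  \det M = 1 -> H tau -> 0 < e -> e * (height M)%:R <= normc (den M tau) ->
  normc (cocycle M tau) <= e^-1.
Proof.
move=> dM t0 e0 He.
have p0 : 0 < normc (den M tau) by rewrite normc_gt0// den_neq0.
rewrite /cocycle normcM normcV normcM.
have -> : normc tpi = 2 * pi.
  rewrite /normc/= expr0n add0r sqrtr_sqr ger0_norm//.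
  by rewrite mulr_ge0// pi_ge0.
have -> : normc ((M 1 0)%:~R : C) = `|M 1%R 0%R|%N%:R.
  by rewrite intrC normc_real natr_absz intr_norm.
rewrite invfM mulrCA -[leRHS]mul1r ler_pM//.
- by rewrite invr_ge0 mulr_ge0// pi_ge0.
- by rewrite mulr_ge0// invr_ge0 ltW.
- by rewrite invf_le1; have := pi_ge2 R; lra.
rewrite ler_pdivrMr// mulrC ler_pdivlMr//; apply: le_trans He.
by rewrite mulrC ler_wpM2l ?(ltW e0)// ler_nat leq_addr.
Qed.

(** The cocycle is bounded near tau uniformly in M, so every derivative of
    q^N|_l M is dominated like q^N|_l M itself. *)
Lemma locally_dominated_slash_qpow (l N n : nat) : (4 <= l)%N ->
  locally_dominated (fun (x : cosets) tau =>
    slash_chain l (qpow_chain N) (val (repr x)) n tau).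
Proof.
move=> l4 tau t0; have [e e01 He] := den_lower_bound t0.
have e0 : 0 < e by case/andP: e01.
exists (complex.Im tau / 2); first by rewrite divr_gt0.
pose K := \sum_(j < n.+1) normc (quasi_coef R l n j) *
  (N%:R ^+ j * e ^- (l + 2 * j)) * e^-1 ^+ (n - j).
exists (fun x => K * (height (val (repr x)))%:R ^- 4).
  apply: bounded_sumsZ bounded_sums_coset.
  apply: sumr_ge0 => j _.
  by rewrite !mulr_ge0 ?normc_ge0 ?exprn_ge0 ?invr_ge0 ?exprn_ge0// ltW.
move=> x h hh; set M := val (repr x).
have dM : \det M = 1 by exact: det_SL2Z.
have th : H (tau + h).
  apply: upper_half_plane_disc => //; apply: lt_trans hh _.
  by rewrite ltr_pdivrMr// ltr_pMr// ltr1n.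
have Hd := He M h hh.
rewrite /slash_chain horner_quasi_poly; apply: le_trans (normc_sum _ _) _.
rewrite /K mulr_suml; apply: ler_sum => j _.
have nM (a b c : C) p :
    normc (a * b * (- c) ^+ p) = normc a * normc b * normc c ^+ p.
  by rewrite !normcM normcX normcN.
rewrite nM [leRHS]mulrAC.
apply: ler_pM; rewrite ?mulr_ge0 ?normc_ge0 ?exprn_ge0 ?normc_ge0//.
  rewrite -mulrA ler_wpM2l ?normc_ge0//.
  exact: normc_slash_qpow.
by rewrite lerXn2r ?nnegrE ?normc_ge0 ?invr_ge0 ?(ltW e0)//; exact: normc_cocycle.
Qed.

End Poincare.

(** * Covariance of the bracket and the theorem *)

Section Main.
Variable R : realType.
Local Notation C := (R[i]).
Local Notation H := (@upper_half_plane R).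
Implicit Types (M : 'M[int]_2) (tau : C).

Lemma rankin_cohen_chain (k l : int) n (f g : C -> C) F G tau :
  D_chain F -> (forall z, H z -> f z = F 0%N z) ->
  D_chain G -> (forall z, H z -> g z = G 0%N z) -> H tau ->
  rankin_cohen k l n f g tau =
    \sum_(j < n.+1) rc_coef R k l n j * (F j tau * G (n - j)%N tau).
Proof.
move=> cF fF cG gG t0; apply: eq_bigr => j _.
by rewrite (D_chain_iter cF)// (D_chain_iter cG)// mulrA.
Qed.

(** Evaluating [rc_quasi_poly] at -w: the bracket of the slashed functions is the
    slash of the bracket, in weight k + l + 2 n. *)
Lemma rc_slash_chain (k l : int) n F G M tau :
  \det M = 1 -> H tau ->
  \sum_(j < n.+1) rc_coef R k l n j *
     (slash_chain k F M j tau * slash_chain l G M (n - j) tau) =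
  den M tau ^ (- (k + l + (2 * n)%N%:Z)) *
    \sum_(j < n.+1) rc_coef R k l n j *
      (F j (mobius M tau) * G (n - j)%N (mobius M tau)).
Proof.
move=> dM t0; have d0 := den_neq0 dM t0.
have := congr1 (fun p => p.[- cocycle M tau])
  (rc_quasi_poly k l (slash_seq k F M tau) (slash_seq l G M tau) n).
rewrite hornerC horner_sum => E.
rewrite mulr_sumr; transitivity (\sum_(j < n.+1) rc_coef R k l n j *
      (slash_seq k F M tau j * slash_seq l G M tau (n - j))).
  by rewrite -E; apply: eq_bigr => j _; rewrite hornerZ hornerM.
apply: eq_bigr => j _; rewrite /slash_seq !slashE.
rewrite (_ : - (k + l + _) = - (k + (2 * j)%N%:Z) + - (l + (2 * (n - j))%N%:Z)).
  by rewrite expfzDr//; ring.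
by have := leq_ord j; lia.
Qed.

End Main.

Theorem theorem2 (R : realType) (k : int) (f : R[i] -> R[i]) (l m N : nat)
    (k_even : (2 %| k)%Z) (f_modular : modular_form k f)
    (l_even : ~~ odd l) (l_ge4 : (4 <= l)%N)
    (weight_cond : ~ cusp_form k f -> k + 2 <= l%:Z) :
  let phi := fun tau : R[i] =>
    q tau ^+ N *
    \sum_(r < m.+1) (-1) ^+ r
      * gbinomial R (k + m%:Z - 1) (m - r) * gbinomial R (l%:Z + m%:Z - 1) r
      * N%:R ^+ (m - r) * iter r (@D R) f tau in
  let w := k + l%:Z + (2 * m)%N%:Z in
  forall tau : R[i], upper_half_plane tau ->
    poincare_abs_cvg w phi tau /\
    rankin_cohen k l%:Z m f (poincareN l%:Z N) tau = poincare w phi tau.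
Proof.
move=> phi w tau t0.
have [_ f_inv [a fa]] := f_modular.
have [F cF fF] := fourier_chain fa.
pose Q := @qpow_chain R N.
have cQ : D_chain Q by exact: D_chain_qpow.
pose G (n : nat) (x : cosets) := slash_chain l Q (val (repr x)) n.
have cG x : D_chain (fun n => G n x).
  by apply: D_chain_slash => //; exact: det_SL2Z.
have dG n : locally_dominated (G n) by exact: locally_dominated_slash_qpow.
pose P n z := summability.sum (fun x => G n x z : R[i]^o).
have cP : D_chain P by exact: D_chain_sum.
have P0 z : poincareN l N z = P 0%N z.
  rewrite /poincareN /poincare (_ : poincare_term _ _ z = fun x => G 0%N x z)//.
  apply/funext => x; rewrite /G slash_chain0 /poincare_term !slashE.
  by rewrite /Q /qpow_chain expr0 mul1r.
(* As f = f|_k M, the coset of M contributes a bracket of two slashed functions. *)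
have term x : poincare_term w phi tau x =
    \sum_(j < m.+1) rc_coef R k l m j * (F j tau * G (m - j)%N x tau).
  have dM : \det (val (repr x)) = 1 by exact: det_SL2Z.
  have Mt := upper_half_plane_mobius dM t0.
  have Fx n : slash_chain k F (val (repr x)) n tau = F n tau.
    apply: D_chain_invariant => // z zH.
    by rewrite slashE -!fF//; [exact: f_inv|exact: upper_half_plane_mobius].
  under eq_bigr => j _ do rewrite -Fx.
  rewrite rc_slash_chain// /poincare_term slashE; congr (_ * _).
  rewrite /phi mulr_sumr; apply: eq_bigr => j _.
  by rewrite (D_chain_iter cF)// /Q /qpow_chain /rc_coef; ring.
split.
  have /choice[B HB] : forall j : 'I_m.+1, exists B, bounded_sums B /\
      forall x, normc (G (m - j)%N x tau) <= B x.
    move=> j; have [d d0 [B bB GB]] := dG (m - j)%N tau t0.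
    by exists B; split => // x; have := GB x 0; rewrite addr0; apply; rewrite normc0.
  apply: (@bounded_sums_summable _ _
    (fun x => \sum_(j < m.+1) normc (rc_coef R k l m j * F j tau) * B j x)).
    move=> x; rewrite term; apply: le_trans (normc_sum _ _) _.
    apply: ler_sum => j _; rewrite mulrA [normc (_ * G _ _ _)]normcM.
    by rewrite ler_wpM2l ?normc_ge0//; exact: (HB j).2.
  apply: bounded_sums_sum => j; apply: bounded_sumsZ; first exact: normc_ge0.
  exact: (HB j).1.
rewrite (rankin_cohen_chain k l m cF fF cP _ t0) => [|z _]; last exact: P0.
apply/esym/has_sum_summability.
apply: (@eq_has_sum _ _ (fun x =>
  \sum_(j < m.+1) rc_coef R k l m j * (F j tau * G (m - j)%N x tau))) => [x|].
  by rewrite term.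
apply: has_sum_sum => j; do 2 apply: has_sumZ.
exact: locally_dominated_has_sum.
Qed.
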